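(* Let $1<q<p<\infty$ and let $\phi$ be a positive increasing function on $[0,1)$ such that $$\int_0^1(1-r)^{p-2}\phi(r)^p\,dr<\infty \qquad\text{and}\qquad \int_0^1(1-r)^{q-2}\phi(r)^q\,dr=\infty .$$ Then there exists a function $f\in (B^p\cap H^\infty)\setminus B^q$ with the following two properties: (i) there exist constants $C>0$ and $r_0\in(0,1)$ such that $M_p(r,f')\ge C\,\phi(r)$ for all $r\in[r_0,1)$; (ii) for every $\theta\in[0,2\pi]$, $$\int_0^1(1-r)^{q-2}\,|f'(re^{i\theta})|^q\,dr=\infty .$$
   Context: $\mathbb D=\{z\in\mathbb C:|z|<1\}$, and $dA(z)=\frac1\pi\,dx\,dy$ is normalized area measure on $\mathbb D$. For $g$ analytic in $\mathbb D$, $0\le r<1$ and $0<p<\infty$, $M_p(r,g)=\left(\frac{1}{2\pi}\int_0^{2\pi}|g(re^{i\theta})|^p\,d\theta\right)^{1/p}$. $H^\infty$ is the space of bounded analytic functions on $\mathbb D$. For $1<p<\infty$, the analytic Besov space $B^p$ is the set of functions $f$ analytic in $\mathbb D$ with $\int_{\mathbb D}(1-|z|^2)^{p-2}|f'(z)|^p\,dA(z)<\infty$. *)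

(* Defs.v *)
From HB Require Import structures.
From mathcomp Require Import all_boot all_order all_algebra.
From mathcomp Require Import all_classical all_reals all_analysis.
From mathcomp Require Import complex.
Import Order.TTheory GRing.Theory Num.Theory.
Import numFieldNormedType.Exports.
Set Implicit Arguments. Unset Strict Implicit. Unset Printing Implicit Defensive.
Local Open Scope ring_scope.
Local Open Scope classical_set_scope.

(* The complex plane, seen as a normed space over itself (so that
   [derivable] / [^`()] are complex differentiability / complex derivative). *)
Definition Cpl (R : realType) := (R[i])^o.

Definition cabs (R : realType) (z : R[i]) : R :=
  Num.sqrt (complex.Re z ^+ 2 + complex.Im z ^+ 2).

Definition cpt (R : realType) (x y : R) : Cpl R := (x +i* y)%C.

Definition polar (R : realType) (r t : R) : Cpl R := cpt (r * cos t) (r * sin t).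

Definition disc (R : realType) : set (Cpl R) := [set z | cabs z < 1].

Arguments disc R : clear implicits.

Definition analytic_in_disc (R : realType) (g : Cpl R -> Cpl R) : Prop :=
  forall z, disc R z -> derivable g z 1.

Definition Mp (R : realType) (p r : R) (g : Cpl R -> Cpl R) : R :=
  (fine ((2 * pi)^-1%:E *
     \int[@lebesgue_measure R]_(t in `[0%R, (2 * pi)%R]) ((cabs (g (polar r t))) `^ p)%:E)%E)
  `^ (p^-1).

Definition Hinfty (R : realType) (f : Cpl R -> Cpl R) : Prop :=
  analytic_in_disc f /\ exists M : R, forall z, disc R z -> cabs (f z) <= M.

Definition area_integral (R : realType) (F : Cpl R -> R) : \bar R :=
  ((pi^-1)%:E *
   \int[(@lebesgue_measure R \x @lebesgue_measure R)%E]_(xy in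
        [set xy : R * R | (cabs (cpt xy.1 xy.2) < 1)%R])
      (F (cpt xy.1 xy.2))%:E)%E.

Definition Besov (R : realType) (p : R) (f : Cpl R -> Cpl R) : Prop :=
  analytic_in_disc f /\
  (area_integral (fun z => (1 - cabs z ^+ 2) `^ (p - 2) * (cabs (derive1 f z)) `^ p)%R
     < +oo)%E.

(* Main.v *)
(* The function is the lacunary series [f z = \sum_k (psi k / N ^ k) * z ^ (N ^ k)], where [N] is large and
   [psi k] dominates [phi (1 - 1 / N ^ k.+1)].  The weights [psi] are obtained from [phi] by damped summation
   in both directions, which keeps [\sum_k N ^ (- k (p - 1)) * psi k ^ p] finite and forces
   [17 * psi k <= psi k.+1 <= N ^ 2 * psi k].  Then
   - [psi k / N ^ k] is summable, so that [f] is bounded;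
   - [cabs (f' z) <= C * psi k] when [1 / N ^ k.+1 <= 1 - cabs z <= 1 / N ^ k], so that the Besov integral is
     at most a multiple of the finite sum above;
   - when [1 - cabs z] lies between [1 / (2 N ^ k)] and [3 / (4 N ^ k)] the [k]-th term of [f'] dominates all
     the others together, so that [cabs (f' z) >= psi k / 8]; the [q]-integrals, radial or over the disc, are
     at least a multiple of [\sum_k N ^ (- k (q - 1)) * psi k ^ q], which diverges;
   - [Mp p r f'] is at least half the [k]-th Fourier coefficient of [f'] on the circle of radius [r].  *)
Require Import Defs.
From HB Require Import structures.
From mathcomp Require Import all_boot all_order all_algebra.
From mathcomp Require Import all_classical all_reals all_analysis.
From mathcomp Require Import measurable_realfun complex.
From mathcomp Require Import ring lra.
Import Order.TTheory GRing.Theory Num.Theory.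
Import numFieldNormedType.Exports.
Local Open Scope ring_scope.
Local Open Scope classical_set_scope.
Set Implicit Arguments.
Unset Strict Implicit.
Unset Printing Implicit Defensive.

(** * Comparison of integrals with series over level sets *)

Section integral_bounds.
Context d (T : measurableType d) (R : realType) (mu : {measure set T -> \bar R}).
Implicit Types (D : set T) (A : nat -> set T) (c a : nat -> R).

(** The relation [phi <= psi] at the sample points is one-sided: divergence of the [q]-sum and the
    lower bound for the means pass from [phi] to [psi] by comparison, so only convergence of the
    [p]-sum has to survive the regularization. The samples of [phi] cannot serve as coefficients
    themselves: where they are nearly constant no term of [f'] stands out, and where they jump the
    later terms are out of control. Growth by at least 17 makes the terms before the [k]-th sum to
    at most [psi k / 16]; growth by at most [N ^ 2] is beaten in the tail by the decay of
    [r ^ (N ^ k)], which gains a cube against that square. Growth of [psi] by 17 multiplies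
    [psi ^ p] by [17 ^ p] per level, which weights decaying by [N ^ (p - 1)] must outweigh; hence
    [N] depends on [p]. Integrands are never shown measurable: each integral is compared with a step
    function on intervals or annuli, through the supremum that defines the integral of a nonnegative
    function. *)

Lemma le_integral_nonmeasurable D (f g : T -> \bar R) :
  (forall x, D x -> 0 <= f x)%E -> (forall x, D x -> f x <= g x)%E ->
  (\int[mu]_(x in D) f x <= \int[mu]_(x in D) g x)%E.
Proof.
(* Both sides become suprema over the simple functions below the integrand, and a simple function
   below [f] is below [g]. *)
move=> f0 fg; rewrite !ge0_integralE//; last first.
  by move=> x Dx; exact: le_trans (f0 x Dx) (fg x Dx).
apply: ereal_sup_le => _ [h hf <-]; exists h => // x.
by apply: le_trans (hf x) _; apply: lee_restrict.
Qed.

Lemma integral_scaled_indic (E : set T) (e : R) : measurable E -> 0 <= e ->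
  (\int[mu]_x (e * \1_E x)%:E = e%:E * mu E)%E.
Proof.
move=> mE e0; under eq_integral do rewrite EFinM.
rewrite ge0_integralZl_EFin//; last by apply/measurable_EFinP; exact: measurable_indic.
by rewrite integral_indic// setIT.
Qed.

(** The majorant is the sum of [c k] times the indicator of [A k]. Overlaps only enlarge it, so a
    cover of [D] is enough. *)
Lemma integral_le_series D A c a (F : T -> R) (B : R) :
  (forall k, measurable (A k)) -> (forall k, 0 <= c k) ->
  (forall x, D x -> 0 <= F x) ->
  (forall x, D x -> exists2 k, A k x & F x <= c k) ->
  (forall k, mu (A k) <= (a k)%:E)%E ->
  (forall K, \sum_(k < K) c k * a k <= B) ->
  (\int[mu]_(x in D) (F x)%:E <= B%:E)%E.
Proof.
move=> mA c0 F0 FA Aa caB.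
pose G (k : nat) (x : T) : \bar R := (c k * \1_(A k) x)%:E.
have mG k : measurable_fun [set: T] (G k).
  by apply/measurable_EFinP; apply: measurable_funM => //; exact: measurable_indic.
have G0 k x : [set: T] x -> (0 <= G k x)%E.
  by move=> _; rewrite lee_fin mulr_ge0// indicE.
rewrite integral_mkcond.
apply: (@le_trans _ _ (\int[mu]_x (\sum_(k <oo) G k x))%E).
  apply: le_integral_nonmeasurable => x _.
    by apply: erestrict_ge0 => y Dy; rewrite lee_fin F0.
  rewrite patchE; case: ifPn => [|_]; last by apply: nneseries_ge0 => k _ _; exact: G0.
  rewrite inE => /FA[k Ax Fx].
  rewrite (nneseriesD1 (n := k))//; last by move=> *; exact: G0.
  rewrite -[X in (X <= _)%E]adde0; apply: leeD; last by apply: nneseries_ge0 => *; exact: G0.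
  by rewrite lee_fin indicE mem_set// mulr1.
rewrite integral_nneseries//.
apply: lime_le; first by apply: is_cvg_nneseries => k _ _; apply: integral_ge0 => x _; exact: G0.
apply: nearW => K; rewrite big_mkord.
apply: le_trans (_ : (\sum_(k < K) (c k * a k)%:E <= _)%E); last first.
  by rewrite sumEFin lee_fin.
apply: lee_sum => k _.
by rewrite /G integral_scaled_indic// EFinM lee_wpmul2l ?lee_fin.
Qed.

(** Disjointness lets at most one term of the minorant survive at each point, so that it stays below
    [F]. *)
Lemma series_le_integral D A c a (F : T -> R) K :
  (forall k, measurable (A k)) -> (forall k, 0 <= c k) ->
  (forall x, D x -> 0 <= F x) -> trivIset setT A ->
  (forall k x, A k x -> D x /\ c k <= F x) ->
  (forall k, (a k)%:E <= mu (A k))%E ->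
  ((\sum_(k < K) c k * a k)%:E <= \int[mu]_(x in D) (F x)%:E)%E.
Proof.
move=> mA c0 F0 tA AF aA.
pose G (k : nat) (x : T) : \bar R := (c k * \1_(A k) x)%:E.
have mG k : measurable_fun [set: T] (G k).
  by apply/measurable_EFinP; apply: measurable_funM => //; exact: measurable_indic.
have G0 k x : [set: T] x -> (0 <= G k x)%E.
  by move=> _; rewrite lee_fin mulr_ge0// indicE.
rewrite integral_mkcond.
apply: (@le_trans _ _ (\int[mu]_x (\sum_(k < K) G k x))%E); last first.
  apply: le_integral_nonmeasurable => x _; first by apply: sume_ge0 => k _; exact: G0.
  have [[k Ax]|nA] := pselect (exists k : 'I_K, A k x).
    rewrite (bigD1 k)//= big1 ?adde0 => [|i ik].
      by rewrite patchE mem_set /G ?indicE ?mem_set// ?mulr1 ?lee_fin; case: (AF k x Ax).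
    rewrite /G indicE memNset ?mulr0// => Aix.
    by move/eqP: ik; apply; apply/val_inj/(tA i k) => //; exists x.
  rewrite big1 => [|i _].
    by apply: erestrict_ge0 => y Dy; rewrite lee_fin F0.
  by rewrite /G indicE memNset ?mulr0// => Aix; apply: nA; exists i.
rewrite -sumEFin (ge0_integral_sum mu measurableT (fun k : 'I_K => mG k) (fun k : 'I_K => G0 k)); apply: lee_sum => k _.
by rewrite /G integral_scaled_indic// EFinM lee_wpmul2l ?lee_fin.
Qed.

End integral_bounds.

(** * Area of annuli under the product measure *)

Section annulus.
Variable R : realType.
Local Notation mu := (@lebesgue_measure R).
Local Notation mu2 := (mu \x mu)%E.

Lemma itv_cc_length (u v : R) : u <= v -> mu `[u, v]%classic = (v - u)%:E.
Proof.
move=> uv; rewrite lebesgue_measure_itv/= lte_fin.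
by case: ifPn => [_|]; rewrite -?EFinB//; rewrite -leNgt => h; congr EFin; lra.
Qed.

Lemma itv_co_length (u v : R) : u <= v -> mu `[u, v[%classic = (v - u)%:E.
Proof.
move=> uv; rewrite lebesgue_measure_itv/= lte_fin.
by case: ifPn => [_|]; rewrite -?EFinB//; rewrite -leNgt => h; congr EFin; lra.
Qed.

Lemma measurable_cabs :
  measurable_fun [set: R * R] (fun z => cabs (cpt z.1 z.2)).
Proof.
have msqrt : measurable_fun [set: R] (@Num.sqrt R).
  by apply: continuous_measurable_fun; exact: sqrt_continuous.
apply: (measurableT_comp msqrt); apply: measurable_funD; apply: measurable_funX.
  exact: measurable_fst.
exact: measurable_snd.
Qed.

Lemma measurable_set_ler (f g : R * R -> R) :
  measurable_fun setT f -> measurable_fun setT g -> measurable [set z | f z <= g z].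
Proof.
move=> mf mg; rewrite (_ : [set z | _] = setT `&` (fun z => g z - f z) @^-1` `[0, +oo[).
  exact: (measurable_funB mg mf measurableT (measurable_itv _)).
by apply/seteqP; split => z /=; rewrite in_itv/= andbT subr_ge0// => -[].
Qed.

Lemma measurable_annulus (I : interval R) :
  measurable [set z : R * R | cabs (cpt z.1 z.2) \in I].
Proof.
rewrite -[X in measurable X]setTI.
exact: measurable_cabs (measurable_itv I).
Qed.

(* The restriction to [`|x| <= `|y|] keeps the slice away from the vertical tangents of the circles, where
   its length is not comparable to [b - a]. *)
Lemma annulus_slice_length (a b x : R) : 0 <= a -> a <= b -> b <= 1 -> 2^-1 <= b ->
  (mu [set y | ((a <= Num.sqrt (x ^+ 2 + y ^+ 2) < b) && (`|x| <= `|y|))%R]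
   <= (12 * (b - a) * \1_(`[-1, 1]%classic : set R) x)%:E)%E.
Proof.
move=> a0 ab b1 b2; set Y := [set y | _].
have [[y0 /andP[/andP[ay yb] xy]]|nY] := pselect (exists y, Y y); last first.
  rewrite (_ : Y = set0) ?measure0 ?lee_fin; last by rewrite -subset0 => y Yy; apply: nY; exists y.
  by rewrite mulr_ge0 ?mulr_ge0 ?subr_ge0 ?indicE.
have b0 : 0 <= b by lra.
have xle : x ^+ 2 <= y0 ^+ 2.
  by rewrite -(real_normK (num_real x)) -(real_normK (num_real y0)) lerXn2r ?nnegrE.
have x2y : x ^+ 2 + y0 ^+ 2 < b ^+ 2.
  rewrite -(ltr_sqrt (x ^+ 2 + y0 ^+ 2)) ?sqrtr_sqr ?ger0_norm//.
  by rewrite exprn_gt0//; lra.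
have x2 : 2 * x ^+ 2 <= b ^+ 2 by lra.
have b21 : b ^+ 2 <= 1 by rewrite expr_le1.
have b24 : 4^-1 <= b ^+ 2 by rewrite (_ : 4^-1 = (2^-1)^+2) ?lerXn2r ?nnegrE//; lra.
have x1 : -1 <= x <= 1 by nra.
pose al := Num.sqrt (a ^+ 2 - x ^+ 2); pose be := Num.sqrt (b ^+ 2 - x ^+ 2).
have al0 : 0 <= al by exact: sqrtr_ge0.
have be0 : 0 <= be by exact: sqrtr_ge0.
have be2 : be ^+ 2 = b ^+ 2 - x ^+ 2 by rewrite sqr_sqrtr//; lra.
(* The restriction on the slice gives [be ^+ 2 >= b ^+ 2 / 2 >= 1 / 8]. *)
have be3 : 3^-1 <= be by rewrite -(ger0_norm (x := 3^-1))// -sqrtr_sqr ler_wsqrtr//; lra.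
have ab2 : a ^+ 2 <= b ^+ 2 by rewrite lerXn2r.
have albe2 : be ^+ 2 - al ^+ 2 <= b ^+ 2 - a ^+ 2.
  rewrite be2; have [h|h] := leP (x ^+ 2) (a ^+ 2).
    by rewrite sqr_sqrtr ?subr_ge0//; lra.
  by rewrite (_ : al = 0) ?expr0n/=; [lra|rewrite /al ler0_sqrtr//; lra].
have albe : al <= be by rewrite /al /be ler_wsqrtr//; lra.
(* [be ^+ 2 - al ^+ 2] is at most [2 * (b - a)] and [be + al] at least [1 / 3]. The slice lies in
   two such intervals, hence the 12. *)
have L : be - al <= 6 * (b - a) by nra.
rewrite indicE mem_set ?mulr1; last by rewrite /= in_itv.
apply: (@le_trans _ _ (mu (`[- be, - al]%classic `|` `[al, be]%classic))).
  apply: le_measure; rewrite ?inE.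
  - rewrite [Y](_ : _ = [set y | cabs (cpt x y) \in `[a, b[%R] `&` [set y | `|x| <= `|y|])//.
    + apply: measurableI.
        rewrite (_ : [set y | _] = xsection [set z : R * R | cabs (cpt z.1 z.2) \in `[a, b[%R] x).
          exact: measurable_xsection (measurable_annulus _).
        by apply/seteqP; split => y; rewrite /xsection /= inE.
      rewrite -[X in measurable X]setTI (_ : [set y | _] = (fun y : R => `|y|) @^-1` `[`|x|, +oo[).
        exact: (normr_measurable measurableT (measurable_itv _)).
      by apply/seteqP; split => y /=; rewrite in_itv/= andbT.
    + apply/seteqP; split => y /=; rewrite in_itv/=; first by move=> /andP.
      by move=> [? ?]; apply/andP.
  - by apply: measurableU.
  - move=> y /andP[/andP[h1 h2] h3].
    have y0' : 0 <= x ^+ 2 + y ^+ 2 by rewrite addr_ge0 ?sqr_ge0.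
    have h1' : a ^+ 2 <= x ^+ 2 + y ^+ 2.
      by rewrite -(sqr_sqrtr y0') lerXn2r ?nnegrE ?sqrtr_ge0.
    have h2' : x ^+ 2 + y ^+ 2 <= b ^+ 2.
      by rewrite -(sqr_sqrtr y0') lerXn2r ?nnegrE ?sqrtr_ge0// ltW.
    have h4 : al <= `|y| by rewrite -sqrtr_sqr ler_wsqrtr//; lra.
    have h5 : `|y| <= be by rewrite -sqrtr_sqr ler_wsqrtr//; lra.
    have [yp|yn] := leP 0 y.
      by right => /=; rewrite in_itv/=; move: h4 h5; rewrite ger0_norm// => -> ->.
    by left => /=; rewrite in_itv/=; move: h4 h5; rewrite ltr0_norm// => h4 h5; lra.
apply: (le_trans (measureU2 mu (measurable_itv _) (measurable_itv _))).
apply: (@le_trans _ _ ((- al - - be)%:E + (be - al)%:E)%E); last by rewrite -EFinD lee_fin; lra.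
by rewrite -!itv_cc_length// lerN2.
Qed.

(** The diagonals cut the annulus into two pieces exchanged by swapping the coordinates; each has
    slices of length at most [12 * (b - a)] over [[-1, 1]], which gives 24 per piece. *)
Lemma annulus_area_le (a b : R) : 0 <= a -> a <= b -> b <= 1 -> 2^-1 <= b ->
  (mu2 [set z : R * R | cabs (cpt z.1 z.2) \in `[a, b[%R] <= (48 * (b - a))%:E)%E.
Proof.
move=> a0 ab b1 b2; set A := [set z | _].
pose S := A `&` [set z | `|z.1| <= `|z.2| ].
pose S' := A `&` [set z | `|z.2| <= `|z.1| ].
have mA : measurable A by exact: measurable_annulus.
have mS1 : measurable [set z : R * R | `|z.1| <= `|z.2| ].
  apply: measurable_set_ler.
  - by apply: measurableT_comp => //; exact: measurable_fst.
  - by apply: measurableT_comp => //; exact: measurable_snd.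
have mS2 : measurable [set z : R * R | `|z.2| <= `|z.1| ].
  apply: measurable_set_ler.
  - by apply: measurableT_comp => //; exact: measurable_snd.
  - by apply: measurableT_comp => //; exact: measurable_fst.
have mS : measurable S by exact: measurableI.
have mS' : measurable S' by exact: measurableI.
have step (F : R -> \bar R) : (forall x, 0 <= F x)%E ->
    (forall x, F x <= (12 * (b - a) * \1_(`[-1, 1]%classic : set R) x)%:E)%E ->
    (\int[mu]_x F x <= (24 * (b - a))%:E)%E.
  move=> F0 Fle; apply: (@le_trans _ _ (\int[mu]_x (12 * (b - a) * \1_(`[-1, 1]%classic : set R) x)%:E)%E).
    by apply: le_integral_nonmeasurable.
  rewrite integral_scaled_indic//; last by rewrite mulr_ge0// subr_ge0.
  rewrite /= lebesgue_measure_itv/= lte_fin ifT; last lra.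
  by rewrite -EFinB -EFinM lee_fin; lra.
have hS : (mu2 S <= (24 * (b - a))%:E)%E.
  apply: step => x; first exact: measure_ge0.
  apply: le_trans (annulus_slice_length x a0 ab b1 b2).
  rewrite le_eqVlt; apply/orP; left; apply/eqP; congr (mu _).
  apply/seteqP; split => y; rewrite /xsection/= inE /S /A/= in_itv/=.
    by move=> [? ?]; apply/andP.
  by move=> /andP.
have hS' : (mu2 S' <= (24 * (b - a))%:E)%E.
  (* Uniqueness of the product measure allows this piece to be sliced horizontally. *)
  have swap := @product_measure_unique _ _ _ _ _ mu mu (mu \x^ mu)%E
    (fun A1 A2 mA1 mA2 => product_measure2E mu mu mA1 mA2) _ mS'.
  rewrite swap.
  apply: step => x; first exact: measure_ge0.
  apply: le_trans (annulus_slice_length x a0 ab b1 b2).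
  rewrite le_eqVlt; apply/orP; left; apply/eqP; congr (mu _).
  apply/seteqP; split => y; rewrite /ysection/= inE /S' /A/= in_itv/= /cabs/= addrC.
    by move=> [? ?]; apply/andP.
  by move=> /andP.
apply: le_trans (_ : (mu2 (S `|` S') <= _)%E).
  apply: le_measure; rewrite ?inE//; first exact: measurableU.
  by move=> z Az; have [h|/ltW h] := leP `|z.1| `|z.2|; [left|right].
apply: (le_trans (measureU2 mu2 mS mS')).
apply: le_trans (leeD hS hS') _.
by rewrite -EFinD lee_fin; lra.
Qed.

(** The upper arcs over [0 <= x <= 1 / 4] suffice: there [be ^+ 2 - al ^+ 2 >= (b - a) / 2] and
    [be + al <= 2], so each slice has length at least [(b - a) / 4]. *)
Lemma annulus_area_ge (a b : R) : 4^-1 <= a -> a <= b -> b <= 1 ->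
  (((b - a) / 16)%:E <= mu2 [set z : R * R | cabs (cpt z.1 z.2) \in `[a, b]%R ])%E.
Proof.
move=> a4 ab b1; set A := [set z | _].
have mA : measurable A by exact: measurable_annulus.
apply: (@le_trans _ _ (\int[mu]_x ((b - a) / 4 * \1_(`[0, 4^-1]%classic : set R) x)%:E)%E).
  rewrite integral_scaled_indic//; last by rewrite mulr_ge0// subr_ge0.
  rewrite /= lebesgue_measure_itv/= lte_fin ifT; last lra.
  by rewrite -EFinB -EFinM lee_fin; lra.
apply: le_integral_nonmeasurable => x _.
  by rewrite lee_fin mulr_ge0 ?divr_ge0 ?subr_ge0 ?indicE.
rewrite indicE; case: (boolP (x \in _)) => [|_]; last by rewrite mulr0 measure_ge0.
rewrite inE/= in_itv/= => /andP[x0 x4]; rewrite mulr1.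
pose al := Num.sqrt (a ^+ 2 - x ^+ 2); pose be := Num.sqrt (b ^+ 2 - x ^+ 2).
have x2a : x ^+ 2 <= a ^+ 2 by rewrite lerXn2r ?nnegrE//; lra.
have a2b : a ^+ 2 <= b ^+ 2 by rewrite lerXn2r ?nnegrE//; lra.
have b21 : b ^+ 2 <= 1 by rewrite expr_le1//; lra.
have al0 : 0 <= al by exact: sqrtr_ge0.
have albe : al <= be by rewrite /al /be ler_wsqrtr//; lra.
have al2 : al ^+ 2 = a ^+ 2 - x ^+ 2 by rewrite sqr_sqrtr//; lra.
have be2 : be ^+ 2 = b ^+ 2 - x ^+ 2 by rewrite sqr_sqrtr//; lra.
have be1 : be <= 1 by rewrite -sqrtr1 ler_wsqrtr//; have := sqr_ge0 x; lra.
have L : (b - a) / 4 <= be - al by nra.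
apply: (@le_trans _ _ (mu `[al, be]%classic)).
  rewrite lebesgue_measure_itv/= lte_fin; case: ifPn => [_|]; first by rewrite -EFinB lee_fin.
  by rewrite -leNgt lee_fin => h; lra.
apply: le_measure; rewrite ?inE//; first exact: measurable_xsection.
move=> y; rewrite /= in_itv/= /xsection/= inE /A/= in_itv/= /cabs/= => /andP[h1 h2].
have h1' : al ^+ 2 <= y ^+ 2 by rewrite lerXn2r ?nnegrE//; lra.
have h2' : y ^+ 2 <= be ^+ 2 by rewrite lerXn2r ?nnegrE//; lra.
apply/andP; split.
  by rewrite -[leLHS]ger0_norm; [rewrite -sqrtr_sqr ler_wsqrtr//; lra|lra].
by rewrite -[leRHS]ger0_norm; [rewrite -sqrtr_sqr ler_wsqrtr//; lra|lra].
Qed.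

End annulus.

(** * Real-valued modulus and the Taylor remainder of powers *)

Section modulus.
Variable R : realType.
Implicit Types (z w : R[i]) (x : R).
Local Open Scope complex_scope.

Lemma normr_cabs z : `|z| = (cabs z)%:C.
Proof. exact: normc_def. Qed.

Lemma cabs_ge0 z : 0 <= cabs z.
Proof. exact: sqrtr_ge0. Qed.

Lemma cabs0 : cabs (0 : R[i]) = 0.
Proof. by apply: complexI; rewrite -normr_cabs normr0. Qed.

Lemma cabsM z w : cabs (z * w) = cabs z * cabs w.
Proof. by apply: complexI; rewrite rmorphM/= -!normr_cabs normrM. Qed.

Lemma cabsX z n : cabs (z ^+ n) = cabs z ^+ n.
Proof. by apply: complexI; rewrite rmorphXn/= -!normr_cabs normrX. Qed.

Lemma cabsN z : cabs (- z) = cabs z.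
Proof. by apply: complexI; rewrite -!normr_cabs normrN. Qed.

Lemma cabs_real x : cabs x%:C = `|x|.
Proof. by rewrite /cabs/= expr0n addr0 sqrtr_sqr. Qed.

Lemma ler_cabsD z w : cabs (z + w) <= cabs z + cabs w.
Proof. by rewrite -lecR rmorphD/= -!normr_cabs ler_normD. Qed.

Lemma ler_cabsB z w : cabs z - cabs w <= cabs (z - w).
Proof. by have := ler_cabsD (z - w) w; rewrite subrK; lra. Qed.

Lemma ler_cabs_sum I (r : seq I) (P : pred I) (F : I -> R[i]) :
  cabs (\sum_(i <- r | P i) F i) <= \sum_(i <- r | P i) cabs (F i).
Proof.
elim/big_ind2: _ => [|x1 x2 y1 y2 h1 h2|//]; first by rewrite cabs0.
by apply: le_trans (ler_cabsD _ _) _; exact: lerD.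
Qed.

Lemma ler_Re_cabs z : `|complex.Re z| <= cabs z.
Proof. by rewrite -sqrtr_sqr ler_wsqrtr// lerDl sqr_ge0. Qed.

Lemma ler_Im_cabs z : `|complex.Im z| <= cabs z.
Proof. by rewrite -sqrtr_sqr ler_wsqrtr// lerDr sqr_ge0. Qed.

(** Induction on the exponent: the next remainder is [w] times the current one plus
    [n.+2%:R * z ^+ n.+1 * (w - z) ^+ 2], and [m ^+ 2 + m <= (m + 1) ^+ 2]. Starting at exponent 2
    avoids truncated subtraction. *)
Lemma exprn_taylor (z w : R[i]) (rho : R) n : cabs z <= rho -> cabs w <= rho ->
  cabs (w ^+ n.+2 - z ^+ n.+2 - n.+2%:R * z ^+ n.+1 * (w - z))
    <= n.+2%:R ^+ 2 * rho ^+ n * cabs (w - z) ^+ 2.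
Proof.
move=> zr wr; have r0 : 0 <= rho := le_trans (cabs_ge0 z) zr.
elim: n => [|n IHn].
  rewrite (_ : w ^+ 2 - _ - _ = (w - z) ^+ 2); last by ring.
  rewrite cabsX expr0 mulr1 ler_peMl ?exprn_ge0 ?cabs_ge0//; lra.
rewrite (_ : w ^+ n.+3 - _ - _ =
  w * (w ^+ n.+2 - z ^+ n.+2 - n.+2%:R * z ^+ n.+1 * (w - z)) + n.+2%:R * z ^+ n.+1 * (w - z) ^+ 2); last first.
  by rewrite -[n.+3%:R]natr1 !exprS; ring.
apply: le_trans (ler_cabsD _ _) _; rewrite cabsM (cabsM _ ((w - z) ^+ 2)) (cabsM n.+2%:R) (cabsX z) (cabsX (w - z)).
have -> : cabs (n.+2%:R : R[i]) = n.+2%:R.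
  by apply: complexI; rewrite -normr_cabs normr_nat rmorph_nat.
have d0 : 0 <= cabs (w - z) ^+ 2 by rewrite exprn_ge0 ?cabs_ge0.
apply: (@le_trans _ _ (rho * (n.+2%:R ^+ 2 * rho ^+ n * cabs (w - z) ^+ 2)
    + n.+2%:R * rho ^+ n.+1 * cabs (w - z) ^+ 2)).
  apply: lerD; first by apply: ler_pM => //; exact: cabs_ge0.
  by rewrite ler_wpM2r// ler_wpM2l// lerXn2r ?nnegrE ?cabs_ge0.
rewrite -[n.+3%:R]natr1 (exprS rho n).
have := ler0n R n.+2; have := exprn_ge0 n r0.
move: (n.+2%:R : R) (rho ^+ n) (cabs _ ^+ 2) d0 => m s d d0 s0 m0.
rewrite -subr_ge0 (_ : _ - _ = rho * s * d * (m + 1)); last by ring.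
by rewrite !mulr_ge0// addr_ge0.
Qed.

End modulus.

(** * Complex series with summable moduli *)

Section summable_complex.
Variable R : realType.
Implicit Types (u v : nat -> R) (w : nat -> R[i]).
Local Open Scope complex_scope.

(** For nonnegative terms this is convergence. A bound on partial sums is what the integral
    comparisons produce and consume, and its negation expresses divergence. *)
Definition bounded_sums u := exists B, forall K, \sum_(k < K) u k <= B.

(** Meaningful when the moduli have [bounded_sums], which makes both real series converge. *)
Definition csum w : R[i] :=
  limn (series (fun k => complex.Re (w k))) +i* limn (series (fun k => complex.Im (w k))).

Lemma bounded_sums_le u v : (forall k, v k <= u k) -> bounded_sums u -> bounded_sums v.
Proof.
by move=> vu [B hB]; exists B => K; apply: le_trans (hB K); apply: ler_sum => k _; exact: vu.
Qed.

Lemma bounded_sumsD u v : bounded_sums u -> bounded_sums v -> bounded_sums (fun k => u k + v k).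
Proof. by move=> [B hB] [C hC]; exists (B + C) => K; rewrite big_split lerD. Qed.

Lemma bounded_sumsZ u c : 0 <= c -> bounded_sums u -> bounded_sums (fun k => c * u k).
Proof. by move=> c0 [B hB]; exists (c * B) => K; rewrite -mulr_sumr ler_wpM2l. Qed.

Lemma geometric_sum_le (x : R) K : 0 <= x -> x < 1 -> \sum_(k < K) x ^+ k <= (1 - x)^-1.
Proof.
move=> x0 x1.
have x1' : 0 < 1 - x by rewrite subr_gt0.
rewrite -[leRHS]mul1r ler_pdivlMr//.
suff -> : (\sum_(k < K) x ^+ k) * (1 - x) = 1 - x ^+ K by rewrite gerBl exprn_ge0.
elim: K => [|K IH]; first by rewrite big_ord0 mul0r expr0 subrr.
by rewrite big_ord_recr/= mulrDl IH exprS; ring.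
Qed.

Lemma bounded_sums_geometric (x : R) : 0 <= x -> x < 1 -> bounded_sums (fun k => x ^+ k).
Proof. by move=> x0 x1; exists (1 - x)^-1 => K; exact: geometric_sum_le. Qed.

Lemma is_cvg_series_bounded_sums u v : (forall k, `|v k| <= u k) -> bounded_sums u ->
  cvgn (series v).
Proof.
move=> vu [B hB]; apply: normed_cvg.
apply: nondecreasing_is_cvgn.
  by apply: nondecreasing_series => k _ _; exact: normr_ge0.
exists B => _ [K _ <-]; rewrite /normed_series_of seriesEord/=; apply: le_trans (hB K).
exact: ler_sum.
Qed.

Lemma csum_cvg w : bounded_sums (fun k => cabs (w k)) ->
  (series (fun k => complex.Re (w k)) @ \oo --> complex.Re (csum w)) /\
  (series (fun k => complex.Im (w k)) @ \oo --> complex.Im (csum w)).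
Proof.
move=> bw; split; apply: (@is_cvg_series_bounded_sums _ _ _ bw) => k;
  [exact: ler_Re_cabs|exact: ler_Im_cabs].
Qed.

Lemma Re_series w n : series (fun k => complex.Re (w k)) n = complex.Re (\sum_(k < n) w k).
Proof.
rewrite seriesEord/=.
by apply: (big_ind2 (fun x z => x = complex.Re z)) => // x1 [a b] x2 [c e] -> ->.
Qed.

Lemma Im_series w n : series (fun k => complex.Im (w k)) n = complex.Im (\sum_(k < n) w k).
Proof.
rewrite seriesEord/=.
by apply: (big_ind2 (fun x z => x = complex.Im z)) => // x1 [a b] x2 [c e] -> ->.
Qed.

Lemma ReB (x y : R[i]) : complex.Re (x - y) = complex.Re x - complex.Re y.
Proof. by case: x y => ? ? []. Qed.

Lemma ImB (x y : R[i]) : complex.Im (x - y) = complex.Im x - complex.Im y.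
Proof. by case: x y => ? ? []. Qed.

(** Continuity of the modulus carries a bound that holds eventually for partial sums to the sum
    itself; head, tail and Taylor estimates all reach [csum] this way. *)
Lemma csum_near w (Z : R[i]) (B : R) L : bounded_sums (fun k => cabs (w k)) ->
  (forall K, (L <= K)%N -> cabs (\sum_(k < K) w k - Z) <= B) -> cabs (csum w - Z) <= B.
Proof.
move=> bw hB; have [cR cI] := csum_cvg bw.
have ccabs : cabs (\sum_(k < n) w k - Z) @[n --> \oo] --> cabs (csum w - Z).
  rewrite /cabs; apply: continuous_cvg; first exact: sqrt_continuous.
  have cvg_sqr (a : nat -> R) (l : R) : a @ \oo --> l -> a n ^+ 2 @[n --> \oo] --> l ^+ 2.
    by move=> al; under eq_fun do rewrite expr2; rewrite expr2; exact: cvgM.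
  rewrite ReB ImB.
  apply: cvgD.
    apply: cvg_sqr.
    rewrite [X in X @ _ --> _](_ : _ = fun n => series (fun k => complex.Re (w k)) n - complex.Re Z).
      by apply: cvgB => //; exact: cvg_cst.
    by apply/funext => n; rewrite Re_series ReB.
  apply: cvg_sqr.
    rewrite [X in X @ _ --> _](_ : _ = fun n => series (fun k => complex.Im (w k)) n - complex.Im Z).
    by apply: cvgB => //; exact: cvg_cst.
  by apply/funext => n; rewrite Im_series ImB.
apply: (cvgr_to_le ccabs); near=> n; apply: hB; near: n; exact: nbhs_infty_ge.
Unshelve. all: by end_near. Qed.

(** The combination is a first-order Taylor remainder: [c] stands for the increment of the variable
    and [w3] for the derived series. *)
Lemma csum_lin w1 w2 w3 (c : R[i]) : bounded_sums (fun k => cabs (w1 k)) ->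
  bounded_sums (fun k => cabs (w2 k)) -> bounded_sums (fun k => cabs (w3 k)) ->
  csum (fun k => w1 k - w2 k - c * w3 k) = csum w1 - csum w2 - c * csum w3.
Proof.
move=> /csum_cvg[r1 i1] /csum_cvg[r2 i2] /csum_cvg[r3 i3].
have E w n : \sum_(k < n) w k = series (fun k => complex.Re (w k)) n +i* series (fun k => complex.Im (w k)) n.
  by rewrite Re_series Im_series; case: (\sum_(k < n) _).
rewrite {1}/csum; move: (csum w1) (csum w2) (csum w3) r1 i1 r2 i2 r3 i3 => [a1 b1] [a2 b2] [a3 b3] /= r1 i1 r2 i2 r3 i3.
have S n : \sum_(k < n) (w1 k - w2 k - c * w3 k)
    = \sum_(k < n) w1 k - \sum_(k < n) w2 k - c * \sum_(k < n) w3 k.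
  by rewrite !sumrB mulr_sumr.
case: c S => [c d] S; apply/eqP; rewrite eq_complex/=; apply/andP; split; apply/eqP; apply/cvg_lim => //.
  rewrite [X in X @ _ --> _](_ : _ = fun n => series (fun k => complex.Re (w1 k)) n - series (fun k => complex.Re (w2 k)) n
    - (c * series (fun k => complex.Re (w3 k)) n - d * series (fun k => complex.Im (w3 k)) n)).
    by apply: cvgB; [exact: cvgB|apply: cvgB; apply: cvgM => //; exact: cvg_cst].
  by apply/funext => n; rewrite Re_series S !E.
rewrite [X in X @ _ --> _](_ : _ = fun n => series (fun k => complex.Im (w1 k)) n - series (fun k => complex.Im (w2 k)) n
    - (c * series (fun k => complex.Im (w3 k)) n + d * series (fun k => complex.Re (w3 k)) n)).
  by apply: cvgB; [exact: cvgB|apply: cvgD; apply: cvgM => //; exact: cvg_cst].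
by apply/funext => n; rewrite Im_series S !E.
Qed.

End summable_complex.

(** * Termwise complex differentiation *)

Section derivative.
Variable R : realType.
Local Open Scope complex_scope.

(** A quadratic remainder bounds the error of the difference quotient at increment [h] by
    [M * cabs h]. *)
Lemma complex_derivative (f : Cpl R -> Cpl R) (z l : Cpl R) (M delta : R) : 0 < delta ->
  (forall w : Cpl R, cabs (w - z) < delta ->
     cabs (f w - f z - l * (w - z)) <= M * cabs (w - z) ^+ 2) ->
  derivable f z 1 /\ derive1 f z = l.
Proof.
move=> d0 fM.
have cl : h^-1 *: (f (h *: (1 : Cpl R) + z) - f z) @[h --> (0 : Cpl R)^'] --> l.
  (* Positivity in [R[i]] forces a zero imaginary part, so the tolerance is the real number [e]. *)
  apply/cvgrPdist_le => -[e e'] /[dup] + ; rewrite ltcE/= => /andP[/eqP -> e0] _.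
  have M0 : 0 < `|M| + 1 by rewrite ltr_pwDr// normr_ge0.
  have d1 : 0 < Num.min delta (e / (`|M| + 1)) by rewrite lt_min d0 divr_gt0.
  near=> h.
  have h0 : h != 0 by near: h; exact: (@nbhs_dnbhs_neq (Cpl R) 0).
  have : `|h| < (Num.min delta (e / (`|M| + 1)))%:C.
    by near: h; apply: (@dnbhs0_lt _ (Cpl R)); rewrite ltcR.
  rewrite normr_cabs ltcR lt_min => /andP[hd he].
  have ch0 : 0 < cabs h by rewrite -ltcR -normr_cabs normr_gt0.
  rewrite normr_cabs lecR.
  have := fM (h + z); rewrite addrK => /(_ hd) H.
  have -> : l - h^-1 *: (f (h *: (1 : Cpl R) + z) - f z) = - (h^-1 * (f (h + z) - f z - l * h)).
    have scE (u v : R[i]) : u *: (v : Cpl R) = u * v by [].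
    by rewrite !scE mulr1 (mulrBr h^-1 (_ - _)) (mulrCA h^-1 l) mulVf// mulr1 opprB.
  rewrite cabsN cabsM.
  have -> : cabs h^-1 = (cabs h)^-1.
    by apply: complexI; rewrite fmorphV/= -!normr_cabs normfV.
  rewrite ler_pdivrMl//; apply: le_trans H _.
  rewrite expr2 mulrCA ler_pM2l// mulrC.
  move: he; rewrite ltr_pdivlMr// => he; apply: le_trans (ltW he).
  by rewrite ler_pM2l//; have := ler_norm M; lra.
split; first by apply/cvg_ex; exists l.
by rewrite derive1E /derive; apply/cvg_lim => //; exact: norm_hausdorff.
Unshelve. all: by end_near. Qed.

(* [e k].-2 and [e k].-1 are truncated, harmlessly: the missing terms carry a zero coefficient. *)
Lemma power_series_derivative (b : nat -> R) (e : nat -> nat) (z : Cpl R) (rho : R) :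
  (forall k, 0 <= b k) -> cabs z < rho ->
  bounded_sums (fun k => b k * rho ^+ e k) ->
  bounded_sums (fun k => b k * (e k)%:R * rho ^+ (e k).-1) ->
  bounded_sums (fun k => b k * ((e k)%:R ^+ 2 * rho ^+ (e k).-2)) ->
  let f := (fun z : Cpl R => csum (fun k => (b k)%:C * z ^+ e k)) : Cpl R -> Cpl R in
  derivable f z 1 /\ derive1 f z = csum (fun k => (b k * (e k)%:R)%:C * z ^+ (e k).-1).
Proof.
move=> b0 zr s0 s1 [B s2] f.
have r0 : 0 <= rho by apply: le_trans (ltW zr); exact: cabs_ge0.
have sum0 w : cabs w <= rho -> bounded_sums (fun k => cabs ((b k)%:C * w ^+ e k)).
  move=> wr; apply: bounded_sums_le s0 => k; rewrite cabsM cabsX cabs_real ger0_norm//.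
  by rewrite ler_wpM2l// lerXn2r ?nnegrE ?cabs_ge0.
have sum1 : bounded_sums (fun k => cabs ((b k * (e k)%:R)%:C * z ^+ (e k).-1)).
  apply: bounded_sums_le s1 => k; rewrite cabsM cabsX cabs_real ger0_norm ?mulr_ge0//.
  by rewrite ler_wpM2l ?mulr_ge0// lerXn2r ?nnegrE ?cabs_ge0// ltW.
apply: (@complex_derivative f z _ B (rho - cabs z)); first by rewrite subr_gt0.
move=> w wz.
have wr : cabs w <= rho.
  by have := ler_cabsD (w - z) z; rewrite subrK => h; apply: le_trans h _; lra.
rewrite /f mulrC -csum_lin; [|exact: sum0|exact/sum0/ltW|exact: sum1].
rewrite -[csum _]subr0; apply: (@csum_near _ _ _ _ 0).
  apply: bounded_sums_le (bounded_sumsD (bounded_sumsD (sum0 _ wr) (sum0 _ (ltW zr)))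
    (bounded_sumsZ (cabs_ge0 (w - z)) sum1)) => k.
  have cabsB3 (u v t : R[i]) : cabs (u - v - t) <= cabs u + cabs v + cabs t.
    rewrite -(cabsN t) -(cabsN v); apply: le_trans (ler_cabsD _ _) _.
    by rewrite lerD2r ler_cabsD.
  by rewrite -(cabsM (w - z)).
move=> K _; rewrite subr0; apply: le_trans (ler_cabs_sum _ _ _) _.
apply: le_trans (_ : (\sum_(k < K) b k * ((e k)%:R ^+ 2 * rho ^+ (e k).-2)) * cabs (w - z) ^+ 2 <= _); last first.
  by rewrite ler_wpM2r ?exprn_ge0 ?cabs_ge0.
rewrite mulr_suml; apply: ler_sum => k _.
rewrite (_ : _ - _ - _ = (b k)%:C * (w ^+ e k - z ^+ e k - (e k)%:R * z ^+ (e k).-1 * (w - z))); last first.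
  by rewrite rmorphM/= rmorph_nat; ring.
rewrite cabsM cabs_real ger0_norm// -[leRHS]mulrA ler_wpM2l//.
(* The remainder vanishes for exponents 0 and 1; from 2 on [exprn_taylor] applies. *)
case: (e k) => [|[|n]] /=; last exact: exprn_taylor (ltW zr) wr.
- by rewrite !expr0 subrr mul0r mul0r subrr cabs0 !mulr_ge0 ?exprn_ge0 ?cabs_ge0.
- by rewrite !expr1 expr0 !mul1r subrr cabs0 !mulr_ge0 ?exprn_ge0 ?cabs_ge0.
Qed.

End derivative.

(** * Regularization of the weights and decay of powers *)

Section regularization.
Variable R : realType.
Implicit Types (c d u : nat -> R).

Lemma bounded_sums_shift u m : (forall k, 0 <= u k) ->
  bounded_sums (fun k => u (m + k)%N) -> bounded_sums u.
Proof.
move=> u0 [B hB]; exists (\sum_(k < m) u k + B) => K.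
apply: (@le_trans _ _ (\sum_(k < m + K) u k)); last by rewrite big_split_ord lerD2l hB.
by rewrite addnC big_split_ord/= lerDl sumr_ge0.
Qed.

Lemma bounded_sums_bounded u : (forall k, 0 <= u k) -> bounded_sums u ->
  exists2 B, 0 <= B & forall k, u k <= B.
Proof.
move=> u0 [B hB]; exists B; first by have := hB 0%N; rewrite big_ord0.
by move=> k; apply: le_trans (hB k.+1); rewrite big_ord_recr/= lerDr sumr_ge0.
Qed.

(** The witness is the convolution of [c] with the powers of [delta]; summing its recursion bounds
    its partial sums by [B / (1 - delta)]. *)
Lemma regularize_forward c (delta : R) : 0 < delta < 1 -> (forall k, 0 <= c k) ->
  bounded_sums c -> exists d, [/\ bounded_sums d, forall k, c k <= d k &
    forall k, delta * d k <= d k.+1].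
Proof.
move=> /andP[d0 d1] c0 [B hB].
pose e := fix e k := if k is k'.+1 then delta * e k' + c k'.+1 else c 0%N.
have e0 k : 0 <= e k by elim: k => [|k IH]//=; rewrite addr_ge0// mulr_ge0// ltW.
have eS k : e k.+1 = delta * e k + c k.+1 by [].
exists e; split; last 2 first.
- by move=> [|k]//; rewrite eS lerDr mulr_ge0// ltW.
- by move=> k; rewrite eS lerDl.
exists (B / (1 - delta)) => K; rewrite ler_pdivlMr ?subr_gt0//.
suff : \sum_(k < K) e k <= delta * \sum_(k < K) e k + \sum_(k < K) c k.
  by have := hB K; nra.
case: K => [|K]; first by rewrite !big_ord0 mulr0 addr0.
have E : \sum_(k < K.+1) e k = delta * \sum_(k < K) e k + \sum_(k < K.+1) c k.
  rewrite big_ord_recl [in RHS]big_ord_recl mulr_sumr /= addrCA -big_split/=.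
  by congr +%R.
by rewrite {1}E lerD2r (ler_wpM2l (ltW d0))// big_ord_recr/= lerDl.
Qed.

(** A second damped sum, now over later terms, is applied to the forward one. It has nonnegative
    coefficients and commutes with shifts, so it keeps the forward inequality while adding the
    backward one. *)
Lemma regularize c (delta : R) : 0 < delta < 1 -> (forall k, 0 <= c k) ->
  bounded_sums c -> exists d, [/\ bounded_sums d, forall k, c k <= d k,
    forall k, delta * d k <= d k.+1 & forall k, delta * d k.+1 <= d k].
Proof.
move=> d01 c0 /(regularize_forward d01 c0)[e [be ce he]].
have /andP[d0 d1] := d01.
have e0 k : 0 <= e k by apply: le_trans (ce k).
have [M M0 eM] := bounded_sums_bounded e0 be.
pose P k L := \sum_(i < L) delta ^+ i * e (k + i)%N.
have P0 k L : 0 <= P k L by apply: sumr_ge0 => i _; rewrite mulr_ge0// exprn_ge0// ltW.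
have PS k L : P k L.+1 = e k + delta * P k.+1 L.
  rewrite /P big_ord_recl/= expr0 mul1r addn0 mulr_sumr; congr +%R.
  by apply: eq_bigr => i _; rewrite /= exprS mulrA addnS.
have PM k L : P k L <= M / (1 - delta).
  elim: L k => [|L IH] k; first by rewrite /P big_ord0 divr_ge0// subr_ge0 ltW.
  rewrite PS; apply: le_trans (lerD (eM k) (ler_wpM2l (ltW d0) (IH k.+1))) _.
  have : M / (1 - delta) * (1 - delta) = M by rewrite divfK// gt_eqF// subr_gt0.
  by move: (M / _) => X; lra.
(* The sum of the whole series [delta ^+ i * e (k + i)], taken as a supremum of partial sums. *)
pose b k := sup [set P k L | L in [set: nat]].
have hs k : has_sup [set P k L | L in [set: nat]].
  split; first by exists (P k 0%N); exists 0%N.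
  by exists (M / (1 - delta)) => _ [L _ <-].
have Pb k L : P k L <= b k by apply: ub_le_sup; [exact: (hs k).2|exists L].
have bP k C : (forall L, P k L <= C) -> b k <= C.
  by move=> h; apply: ge_sup; [exact: (hs k).1|move=> _ [L _ <-]].
have eb k : e k <= b k.
  by apply: le_trans (Pb k 1%N); rewrite PS /P big_ord0 mulr0 addr0.
have b0 k : 0 <= b k by apply: le_trans (eb k).
exists b; split; last 3 first.
- by move=> k; apply: le_trans (eb k).
- move=> k; rewrite mulrC -ler_pdivlMr//; apply: bP => L; rewrite ler_pdivlMr// mulrC.
  apply: le_trans (Pb k.+1 L); rewrite mulr_sumr; apply: ler_sum => i _.
  by rewrite mulrCA addSn ler_wpM2l// exprn_ge0// ltW.
- move=> k; rewrite mulrC -ler_pdivlMr//; apply: bP => L; rewrite ler_pdivlMr// mulrC.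
  by apply: le_trans (Pb k L.+1); rewrite PS lerDr.
have [B hB] := be.
have bE k : b k <= e k + delta * b k.+1.
  apply: bP => -[|L]; first by rewrite /P big_ord0 addr_ge0// mulr_ge0// ltW.
  by rewrite PS lerD2l (ler_wpM2l (ltW d0)).
exists ((B + delta * (M / (1 - delta))) / (1 - delta)) => K.
rewrite ler_pdivlMr ?subr_gt0//.
have : \sum_(k < K) b k <= \sum_(k < K) e k + delta * \sum_(k < K) b k.+1.
  by rewrite mulr_sumr -big_split/=; apply: ler_sum => k _; exact: bE.
(* The index shift adds at most [b K], bounded independently of [K]; as [delta < 1], the sum of [b]
   is then absorbed on the left. *)
have -> : \sum_(k < K) b k.+1 = \sum_(k < K) b k + b K - b 0%N.
  have : \sum_(k < K.+1) b k = \sum_(k < K) b k + b K by rewrite big_ord_recr.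
  by rewrite big_ord_recl/= => <-; rewrite addrAC subrr add0r.
have : b K <= M / (1 - delta) by apply: bP.
by move: (M / _) => X; have := hB K; have := b0 0%N; nra.
Qed.

Lemma powR_exp (x s : R) k : 0 <= x -> (x ^+ k) `^ s = (x `^ s) ^+ k.
Proof.
move=> x0; elim: k => [|k IH]; first by rewrite !expr0 powR1.
by rewrite !exprS powRM ?exprn_ge0// IH.
Qed.

(** With [s = N ^ ((p - 1) / 2)] the weight drops by [s ^ 2] per level. Regularizing the summands
    with [delta = 1 / s] keeps their ratios between [1 / s] and [s], so [psi ^ p] grows by a factor
    between [s >= 17 ^ p] and [s ^ 3 <= N ^ (2 * p)]. *)
Lemma lacunary_weights (N p : R) (phi : nat -> R) : 1 < N -> 1 < p ->
  17 `^ p <= N `^ ((p - 1) / 2) -> (forall k, 0 < phi k) ->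
  bounded_sums (fun k => (N^-1 ^+ k) `^ (p - 1) * phi k `^ p) ->
  exists psi : nat -> R, [/\ forall k, phi k <= psi k,
    forall k, 17 * psi k <= psi k.+1, forall k, psi k.+1 <= N ^+ 2 * psi k &
    bounded_sums (fun k => (N^-1 ^+ k) `^ (p - 1) * psi k `^ p)].
Proof.
move=> N1 p1 hN phi0 bphi.
have N0 : 0 < N by lra.
have p0 : 0 < p by lra.
have pn0 : p != 0 by rewrite gt_eqF.
pose s := N `^ ((p - 1) / 2).
have s17 : 1 < s.
  apply: lt_le_trans hN; have : (1 : R) `^ p < 17 `^ p by apply: gt0_ltr_powR; rewrite ?nnegrE//; lra.
  by rewrite powR1.
have s0 : 0 < s by lra.
have As : N `^ (p - 1) = s ^+ 2.
  by rewrite /s -powR_mulrn ?powR_ge0// -powRrM; congr powR; lra.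
have yE k : (N^-1 ^+ k) `^ (p - 1) = (s ^+ 2) ^- k.
  have yp : N^-1 `^ (p - 1) = (s ^+ 2)^-1.
    by rewrite -(powR_inv1 (ltW N0)) -powRrM mulN1r powRN As.
  by rewrite powR_exp ?invr_ge0 ?(ltW N0)// yp exprVn.
have d01 : 0 < s^-1 < 1 by rewrite invr_gt0 s0 invf_lt1.
have [|d [bd cd hd1 hd2]] := regularize d01 _ bphi.
  by move=> k; rewrite mulr_ge0 ?powR_ge0.
have A0 k : 0 < (s ^+ 2) ^+ k by rewrite !exprn_gt0.
have d0 k : 0 < d k.
  by apply: lt_le_trans (cd k); rewrite mulr_gt0// powR_gt0// exprn_gt0 ?invr_gt0.
pose a k := (s ^+ 2) ^+ k * d k.
have a0 k : 0 < a k by rewrite mulr_gt0.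
pose psi k := a k `^ p^-1.
have psi0 k : 0 <= psi k by exact: powR_ge0.
have psip k : psi k `^ p = a k by rewrite /psi -powRrM mulVf// powRr1// ltW.
have mono x y : 0 <= x -> 0 <= y -> x `^ p <= y `^ p -> x <= y.
  move=> x0 y0 xy; have := ge0_ler_powR (r := p^-1) _ _ _ xy.
  rewrite -!powRrM mulfV// !powRr1// => -> //; rewrite ?nnegrE ?powR_ge0//.
  by rewrite invr_ge0 ltW.
have aS k : a k.+1 = (s ^+ 2) ^+ k * s ^+ 2 * d k.+1 by rewrite /a exprSr.
exists psi; split => [k|k|k|].
- apply: mono => //; first exact/ltW.
  rewrite psip /a mulrC -ler_pdivrMr//; apply: le_trans (cd k).
  by rewrite yE mulrC.
- apply: mono; rewrite ?mulr_ge0// powRM// !psip.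
  apply: (@le_trans _ _ (s * a k)); first by rewrite (ler_wpM2r (ltW (a0 k))).
  rewrite aS /a; have := hd1 k; rewrite mulrC ler_pdivrMr// => h.
  have := A0 k; move: ((s ^+ 2) ^+ k) => X X0.
  apply: le_trans (_ : s * (X * (d k.+1 * s)) <= _); first by rewrite (ler_wpM2l (ltW s0))// (ler_wpM2l (ltW X0)).
  by rewrite le_eqVlt; apply/orP; left; apply/eqP; ring.
- have N20 : 0 <= N ^+ 2 by rewrite exprn_ge0// ltW.
  apply: mono => //; first by rewrite mulr_ge0.
  rewrite powRM// !psip.
  apply: (@le_trans _ _ (s ^+ 3 * a k)).
    rewrite aS /a; have := hd2 k; rewrite mulrC ler_pdivrMr// => h.
    have := A0 k; move: ((s ^+ 2) ^+ k) => X X0.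
    apply: le_trans (_ : X * s ^+ 2 * (d k * s) <= _); first by rewrite ler_wpM2l// mulr_ge0 ?exprn_ge0 ?(ltW s0) ?(ltW X0).
    by rewrite le_eqVlt; apply/orP; left; apply/eqP; ring.
  rewrite ler_pM2r// -powR_mulrn ?(ltW s0)// -(powR_mulrn 2 (ltW N0)) /s -!powRrM.
  by apply: ler_powR; [exact: ltW|lra].
have [B hB] := bd; exists B => K; apply: le_trans (hB K); apply: ler_sum => k _.
by rewrite yE psip /a mulrA mulVf ?mul1r// gt_eqF.
Qed.

(** For [j > 0], the [j]-th power of [expR (x / j) >= x / j]. *)
Lemma expR_ge_pow (x : R) j : 0 <= x -> x ^+ j <= j%:R ^+ j * expR x.
Proof.
move=> x0; case: j => [|j]; first by rewrite !expr0 mul1r; have := expR_ge1Dx x; lra.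
have -> : expR x = expR (x / j.+1%:R) ^+ j.+1.
  by rewrite -expRM_natl mulrC divfK// pnatr_eq0.
rewrite -exprMn lerXn2r ?nnegrE ?mulr_ge0 ?expR_ge0//.
have := expR_ge1Dx (x / j.+1%:R) => h.
have j0 : 0 < j.+1%:R :> R by rewrite ltr0n.
by rewrite -(ler_pdivrMl _ _ j0) mulrC; apply: le_trans h; rewrite lerDr.
Qed.

(** Since [r <= expR (- (1 - r))], the power [r ^+ m] decays exponentially in [m * (1 - r)]. The
    slack [n <= 2 * m] absorbs the shift from [n = N ^ k] to the exponents [N ^ k - 1] and
    [N ^ k - 2]. *)
Lemma pow_decay (r : R) m (n : R) j : 0 <= r -> r <= 1 -> 0 <= n -> n <= 2 * m%:R ->
  r ^+ m * (n * (1 - r)) ^+ j <= (2 * j)%:R ^+ j.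
Proof.
move=> r0 r1 n0 nm; have r1' : 0 <= 1 - r by lra.
have rle : r <= expR (- (1 - r)) by have := expR_ge1Dx (- (1 - r)); lra.
apply: (@le_trans _ _ (expR (- (m%:R * (1 - r))) * (2 * (m%:R * (1 - r))) ^+ j)).
  apply: ler_pM; rewrite ?exprn_ge0 ?mulr_ge0//.
    by rewrite -mulrN expRM_natl lerXn2r ?nnegrE ?expR_ge0.
  by rewrite lerXn2r ?nnegrE ?mulr_ge0// mulrA ler_wpM2r.
rewrite expRN mulrC ler_pdivrMr ?expR_gt0// natrM !exprMn -mulrA ler_wpM2l ?exprn_ge0//.
by rewrite -exprMn; apply: expR_ge_pow; rewrite mulr_ge0.
Qed.

End regularization.

Lemma bernoulli_le (R : realType) (x : R) n : 0 <= x -> x <= 1 -> 1 - n%:R * (1 - x) <= x ^+ n.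
Proof.
move=> x0 x1; elim: n => [|n IH]; first by rewrite mul0r subr0 expr0.
rewrite exprS -natr1; have := exprn_ge0 n x0.
have : x ^+ n <= 1 by rewrite exprn_ile1.
move: (x ^+ n) IH => s IH s1 s0.
have : 0 <= n%:R * (1 - x) by rewrite mulr_ge0// subr_ge0.
by nra.
Qed.

(** * Domination of the derivative by a single lacunary term *)

Section lacunary.
Variables (R : realType) (N : nat) (psi : nat -> R).
Hypothesis hN : 4 <= N%:R :> R.
(* [432 / tau ^+ 3 / N] bounds the relative size of the tail in [lacunary_tail]; here [tau = 1 / 2]. *)
Hypothesis hy : 432 * 8 * N%:R^-1 <= 16^-1 :> R.
Hypothesis psi0 : forall k, 0 < psi k.
Hypothesis psi_lb : forall k, 17 * psi k <= psi k.+1.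
Hypothesis psi_ub : forall k, psi k.+1 <= N%:R ^+ 2 * psi k.
Local Open Scope complex_scope.

Let N0 : 0 < N%:R :> R. Proof. by apply: lt_le_trans hN; rewrite ltr0n. Qed.
Let y0 : 0 < N%:R^-1 :> R. Proof. by rewrite invr_gt0. Qed.
Let y1 : N%:R^-1 <= 4^-1 :> R. Proof. by rewrite lef_pV2// posrE. Qed.

Let y_lt1 : N%:R^-1 < 1 :> R. Proof. by apply: le_lt_trans y1 _; lra. Qed.

Lemma N_ge4 : (4 <= N)%N.
Proof. by rewrite -(ler_nat R). Qed.

Lemma N_exp_ge4 k : (4 <= N ^ k.+1)%N.
Proof.
apply: leq_trans N_ge4 _; rewrite expnS leq_pmulr// expn_gt0.
by rewrite (leq_trans _ N_ge4).
Qed.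

(** The constant closes the induction because [1 / 16 + 1 = 17 / 16]. *)
Lemma weights_head k : \sum_(j < k) psi j <= psi k / 16.
Proof.
elim: k => [|k IH]; first by rewrite big_ord0; have := psi0 0%N; lra.
by rewrite big_ord_recr/=; have := psi_lb k; lra.
Qed.

Lemma weights_growth k i : psi (k + i)%N <= (N%:R ^+ 2) ^+ i * psi k.
Proof.
elim: i => [|i IH]; first by rewrite addn0 expr0 mul1r.
rewrite addnS exprS -mulrA; apply: le_trans (psi_ub _) _.
by rewrite ler_wpM2l// exprn_ge0// ltW.
Qed.

(** With [X = N ^ i.+1] the weight has grown by at most [X ^ 2], while [pow_decay] with exponent 3
    gives [r ^+ m <= 216 / (X * tau) ^ 3]; the product keeps a factor [1 / X], summable in [i]. Here
    [216 = (2 * 3) ^ 3], doubled by the geometric sum. *)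
Lemma lacunary_tail k (r tau : R) L : 0 <= r -> r <= 1 -> 0 < tau ->
  tau <= N%:R ^+ k * (1 - r) ->
  \sum_(i < L) psi (k + i.+1)%N * r ^+ (N ^ (k + i.+1)).-1
    <= 432 / tau ^+ 3 * N%:R^-1 * psi k.
Proof.
move=> r0 r1 t0 ht.
have t30 : 0 < tau ^+ 3 by rewrite exprn_gt0.
have pk := psi0 k.
apply: (@le_trans _ _ (\sum_(i < L) 216 / tau ^+ 3 * psi k * N%:R^-1 * N%:R^-1 ^+ i)); last first.
  rewrite -mulr_sumr.
  have : \sum_(i < L) N%:R^-1 ^+ i <= (2 : R).
    apply: le_trans (geometric_sum_le _ _ _) _; [exact: ltW|exact: y_lt1|].
    by rewrite -[leRHS]invrK lef_pV2 ?posrE; move: y0 y1; move: (N%:R^-1 : R) => y; lra.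
  have c0 : 0 <= 216 / tau ^+ 3 * psi k * N%:R^-1 by rewrite !mulr_ge0 ?invr_ge0 ?ltW.
  by move/(ler_wpM2l c0); move: (tau ^+ 3)^-1 => T; lra.
apply: ler_sum => i _; set m := (N ^ _).-1.
have e2 : (2 <= N ^ (k + i.+1))%N.
  by rewrite addnS; apply: leq_trans (N_exp_ge4 _).
have nm : N%:R ^+ (k + i.+1) <= 2 * m%:R :> R.
  rewrite -natrX -natrM ler_nat /m; move: (N ^ _)%N e2 => [|[|e]]// _.
  by rewrite succnK mul2n -addnn addnS ltnS addSn ltnS leq_addr.
have := pow_decay 3 r0 r1 (exprn_ge0 _ (ltW N0)) nm; rewrite exprD.
set X := N%:R ^+ i.+1.
have X0 : 0 < X by rewrite exprn_gt0.
have rm0 : 0 <= r ^+ m by rewrite exprn_ge0.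
move=> h.
have {}h : r ^+ m * (X * tau) ^+ 3 <= 216.
  apply: (@le_trans _ _ (6%:R ^+ 3)); last by rewrite -natrX ler_nat.
  apply: le_trans h; rewrite ler_wpM2l// lerXn2r ?nnegrE ?mulr_ge0// ?(ltW t0) ?(ltW X0) ?exprn_ge0 ?(ltW N0)//.
    by rewrite subr_ge0.
  by rewrite [leRHS]mulrAC [leRHS]mulrC (ler_wpM2l (ltW X0)).
apply: (@le_trans _ _ (X ^+ 2 * psi k * r ^+ m)).
  by rewrite ler_wpM2r// /X -exprM mulnC exprM; exact: weights_growth.
have -> : 216 / tau ^+ 3 * psi k * N%:R^-1 * N%:R^-1 ^+ i = psi k * (216 / (tau ^+ 3 * X)).
  have F (T P n Y : R) : T != 0 -> n != 0 -> Y != 0 ->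
      216 / T * P * n^-1 * Y^-1 = P * (216 / (T * (n * Y))).
    by move=> T0 n0 Y0; field; rewrite T0 n0 Y0.
  by rewrite /X (exprS _ i) exprVn F ?gt_eqF ?exprn_gt0.
rewrite mulrAC mulrC ler_pM2l// ler_pdivlMr ?mulr_gt0//.
by apply: le_trans h; rewrite le_eqVlt; apply/orP; left; apply/eqP; ring.
Qed.

Lemma lacunary_summable (r : R) : 0 <= r -> r < 1 ->
  bounded_sums (fun k => psi k * r ^+ (N ^ k).-1).
Proof.
move=> r0 r1; apply: (@bounded_sums_shift _ _ 1) => [k|].
  by rewrite mulr_ge0 ?exprn_ge0 ?(ltW (psi0 _)).
exists (432 / (1 - r) ^+ 3 * N%:R^-1 * psi 0%N) => K.
under eq_bigr do rewrite add1n -[_.+1]add0n.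
by apply: lacunary_tail; rewrite ?subr_gt0 ?expr0 ?mul1r// ltW.
Qed.

(** These second-order terms carry one more factor [X = N ^ k.+1] than those of the derivative,
    hence the exponent 4 in [pow_decay], and [8 = 2 * 4]. *)
Lemma lacunary_summable2 (r : R) : 0 <= r -> r < 1 ->
  bounded_sums (fun k => psi k * N%:R^-1 ^+ k * ((N ^ k)%:R ^+ 2 * r ^+ (N ^ k).-2)).
Proof.
move=> r0 r1; have r1' : 0 < 1 - r by lra.
have c0 : 0 < (1 - r) ^+ 4 by rewrite exprn_gt0.
apply: (@bounded_sums_shift _ _ 1) => [k|].
  by rewrite !mulr_ge0 ?exprn_ge0 ?invr_ge0 ?(ltW N0) ?(ltW (psi0 _)).
apply: (@bounded_sums_le _ (fun k => 8 ^+ 4 / (1 - r) ^+ 4 * psi 0%N * N%:R^-1 ^+ k)); last first.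
  apply: bounded_sumsZ; first by rewrite !mulr_ge0 ?invr_ge0 ?(ltW c0) ?(ltW (psi0 _)).
  by apply: bounded_sums_geometric; [exact: ltW|exact: y_lt1].
move=> k; rewrite add1n; set m := (N ^ _).-2.
have e4 := N_exp_ge4 k.
have nm : N%:R ^+ k.+1 <= 2 * m%:R :> R.
  rewrite -natrX -natrM ler_nat /m; move: (N ^ _)%N e4 => [|[|[|[|e]]]]// _.
  by rewrite /= !mul2n !doubleS !ltnS -addnn; apply: leq_trans (leq_addr _ _) _; rewrite ?leqW.
have := pow_decay 4 r0 (ltW r1) (exprn_ge0 _ (ltW N0)) nm.
rewrite natrX; have := weights_growth 0 k.+1; rewrite add0n -exprM mulnC exprM !(exprVn (N%:R : R)).
have rm0 : 0 <= r ^+ m by rewrite exprn_ge0.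
set X := N%:R ^+ k.+1.
have X0 : 0 < X by rewrite exprn_gt0.
move=> h1 h2.
have {}h2 : r ^+ m * (X * (1 - r)) ^+ 4 <= 8 ^+ 4.
  by apply: le_trans h2 _.
apply: (@le_trans _ _ (X ^+ 2 * psi 0%N * X^-1 * (X ^+ 2 * r ^+ m))).
  by rewrite ler_wpM2r ?mulr_ge0 ?exprn_ge0 ?(ltW X0)// ler_wpM2r// invr_ge0 ltW.
apply: (@le_trans _ _ (8 ^+ 4 / (1 - r) ^+ 4 * psi 0%N * X^-1)); last first.
  rewrite ler_wpM2l ?mulr_ge0 ?invr_ge0 ?(ltW c0) ?(ltW (psi0 _))//.
  by rewrite /X lef_pV2 ?posrE ?exprn_gt0// exprS ler_peMl ?exprn_ge0 ?(ltW N0)//; apply: le_trans hN; rewrite ler1n.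
have -> : X ^+ 2 * psi 0%N * X^-1 * (X ^+ 2 * r ^+ m) = psi 0%N * (X ^+ 3 * r ^+ m).
  by field; rewrite gt_eqF.
have -> : 8 ^+ 4 / (1 - r) ^+ 4 * psi 0%N * X^-1 = psi 0%N * (8 ^+ 4 / ((1 - r) ^+ 4 * X)).
  by field; rewrite !gt_eqF.
rewrite ler_pM2l// ler_pdivlMr ?mulr_gt0//.
by apply: le_trans h2; rewrite le_eqVlt; apply/orP; left; apply/eqP; ring.
Qed.

(** The termwise derivative of the lacunary series: the exponent brought down cancels the [N ^ k] in
    the denominator. *)
Definition lacunary_derivative (z : R[i]) : R[i] :=
  csum (fun k => (psi k)%:C * z ^+ (N ^ k).-1).

Lemma lacunary_term_abs k (z : R[i]) :
  cabs ((psi k)%:C * z ^+ (N ^ k).-1) = psi k * cabs z ^+ (N ^ k).-1.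
Proof. by rewrite cabsM cabsX cabs_real gtr0_norm. Qed.

Lemma lacunary_csummable (z : R[i]) : cabs z < 1 ->
  bounded_sums (fun k => cabs ((psi k)%:C * z ^+ (N ^ k).-1)).
Proof.
move=> z1; apply: bounded_sums_le (lacunary_summable (cabs_ge0 z) z1) => k.
by rewrite lacunary_term_abs.
Qed.

Lemma lacunary_dominant k (z : R[i]) (tau : R) : cabs z < 1 -> 0 < tau ->
  tau <= N%:R ^+ k * (1 - cabs z) ->
  cabs (lacunary_derivative z - (psi k)%:C * z ^+ (N ^ k).-1)
    <= (16^-1 + 432 / tau ^+ 3 * N%:R^-1) * psi k.
Proof.
move=> z1 t0 ht; apply: (csum_near (L := k.+1) (lacunary_csummable z1)) => K kK.
(* A partial sum that reaches past [k], minus its [k]-th term, is a head and a tail. *)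
rewrite -(subnKC kK) big_split_ord/= big_ord_recr/= addrAC addrK.
apply: le_trans (ler_cabsD _ _) _; rewrite mulrDl; apply: lerD.
  apply: le_trans (ler_cabs_sum _ _ _) _; rewrite mulrC.
  apply: le_trans (weights_head k); apply: ler_sum => j _; rewrite lacunary_term_abs.
  by rewrite ler_piMr ?(ltW (psi0 _))// exprn_ile1 ?cabs_ge0// ltW.
apply: le_trans (ler_cabs_sum _ _ _) _.
under eq_bigr do rewrite addSnnS lacunary_term_abs.
by apply: lacunary_tail => //; [exact: cabs_ge0|exact: ltW].
Qed.

(** Bernoulli's inequality leaves at least [psi k / 4] for the [k]-th term; the others contribute at
    most [psi k / 8], one sixteenth from the head and one from the tail by [hy]. *)
Lemma lacunary_lower k (z : R[i]) :
  2^-1 <= N%:R ^+ k * (1 - cabs z) -> N%:R ^+ k * (1 - cabs z) <= 3 / 4 ->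
  psi k / 8 <= cabs (lacunary_derivative z).
Proof.
move=> h1 h2; have nk0 : 0 < N%:R ^+ k :> R by rewrite exprn_gt0.
have z0 := cabs_ge0 z.
have z1 : cabs z < 1.
  rewrite -subr_gt0; suff : 0 < N%:R ^+ k * (1 - cabs z) by rewrite pmulr_rgt0.
  by lra.
have t0 : 0 < 2^-1 :> R by rewrite invr_gt0.
have H := lacunary_dominant z1 t0 h1.
have pk := psi0 k.
have {}H : cabs (lacunary_derivative z - (psi k)%:C * z ^+ (N ^ k).-1) <= psi k / 8.
  apply: le_trans H _; rewrite mulrC ler_wpM2l ?(ltW pk)//.
  have -> : (2^-1 : R) ^+ 3 = 8^-1 by rewrite exprVn -natrX.
  by rewrite invrK; move: hy; move: (N%:R^-1 : R) => y; lra.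
have T : psi k / 4 <= cabs ((psi k)%:C * z ^+ (N ^ k).-1).
  rewrite lacunary_term_abs ler_wpM2l ?(ltW pk)//.
  apply: (@le_trans _ _ (cabs z ^+ (N ^ k))); last by rewrite ler_wiXn2l ?leq_pred// ltW.
  by have := bernoulli_le (N ^ k) z0 (ltW z1); rewrite natrX; lra.
have := ler_cabsB ((psi k)%:C * z ^+ (N ^ k).-1) ((psi k)%:C * z ^+ (N ^ k).-1 - lacunary_derivative z).
by rewrite subKr -(cabsN (_ - lacunary_derivative z)) opprB; lra.
Qed.

(** Taking [tau = 1 / N] turns the tail constant into [432 * N ^ 2]; the [k]-th term and the head
    fit in the 2. *)
Lemma lacunary_upper k (z : R[i]) : cabs z < 1 ->
  N%:R^-1 <= N%:R ^+ k * (1 - cabs z) ->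
  cabs (lacunary_derivative z) <= (2 + 432 * N%:R ^+ 2) * psi k.
Proof.
move=> z1 h; have pk := psi0 k.
have := lacunary_dominant z1 y0 h; rewrite exprVn invrK => H.
have T : cabs ((psi k)%:C * z ^+ (N ^ k).-1) <= psi k.
  by rewrite lacunary_term_abs ler_piMr ?(ltW pk)// exprn_ile1 ?cabs_ge0// ltW.
have := ler_cabsD (lacunary_derivative z - (psi k)%:C * z ^+ (N ^ k).-1) ((psi k)%:C * z ^+ (N ^ k).-1).
rewrite subrK => H2; apply: le_trans H2 _.
apply: le_trans (lerD H T) _.
have -> : 432 * N%:R ^+ 3 / N%:R = 432 * N%:R ^+ 2 :> R by field; rewrite gt_eqF.
by lra.
Qed.

End lacunary.

(** * Integrals of cosine sums and Young's inequality *)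

Section trigonometric_integral.
Variable R : realType.
Local Notation mu := (@lebesgue_measure R).

Lemma sin_natD2pi (n : nat) (x : R) : sin (x + n%:R * (2 * pi)) = sin x.
Proof.
elim: n x => [|n IH] x; first by rewrite mul0r addr0.
rewrite -natr1 mulrDl mul1r addrA sinD.
have -> : 2 * pi = pi *+ 2 :> R by rewrite mulr_natl.
by rewrite cos2pi sin2pi mulr1 mulr0 addr0 -[pi *+ 2]mulr_natl IH.
Qed.

Lemma integral_is_derive (F f : R -> R) (a b : R) : a < b -> continuous f ->
  (forall t : R, is_derive t 1 F (f t)) ->
  (\int[mu]_(t in `[a, b]) (f t)%:E = (F b - F a)%R%:E)%E.
Proof.
move=> ab cf dF.
have cF : continuous F.
  by move=> t; apply/differentiable_continuous/derivable1_diffP; exact: ex_derive.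
rewrite (@continuous_FTC2 _ f F)// ?EFinB//.
- exact: continuous_subspaceT.
- split.
  + by move=> t _; exact: ex_derive.
  + by apply: cvg_at_right_filter; exact: cF.
  + by apply: cvg_at_left_filter; exact: cF.
- by move=> t _; rewrite derive1E; exact: derive_val.
Qed.

Lemma continuous_big_sum K (f : nat -> R -> R) :
  (forall j, continuous (f j)) -> continuous (fun t => \sum_(j < K) f j t).
Proof.
have S K' : (fun t => \sum_(j < K'.+1) f j t) = (fun t => \sum_(j < K') f j t + f K' t).
  by apply/funext => t; rewrite big_ord_recr.
move=> cf; elim: K => [|K IH] t.
  rewrite (_ : (fun _ => _) = cst 0); first exact: cvg_cst.
  by apply/funext => u; rewrite big_ord0.
by rewrite S; apply: cvgD; [exact: IH|exact: cf].
Qed.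

Lemma is_derive_big_sum K (f df : nat -> R -> R) (t : R) :
  (forall j, is_derive t 1 (f j) (df j t)) ->
  is_derive t 1 (fun t => \sum_(j < K) f j t) (\sum_(j < K) df j t).
Proof.
have S K' : (fun t => \sum_(j < K'.+1) f j t) = (fun t => \sum_(j < K') f j t) + f K'.
  by apply/funext => u; rewrite big_ord_recr.
move=> cf; elim: K => [|K IH].
  rewrite big_ord0 (_ : (fun _ => _) = cst 0); first exact: is_derive_cst.
  by apply/funext => u; rewrite big_ord0.
by rewrite S big_ord_recr; exact: is_deriveD.
Qed.

Lemma integral_cos_sum (a : nat -> R) (e : nat -> nat) K k (al be : R) : (k < K)%N ->
  injective e ->
  (\int[mu]_(t in `[0%R, (2 * pi)%R])
     (al * (\sum_(j < K) a j * cos (((e j)%:R - (e k)%:R) * t)) + be)%:E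
   = (2 * pi * (al * a k + be))%:E)%E.
Proof.
move=> kK inje.
have pi0 : 0 < 2 * pi :> R by rewrite mulr_gt0// pi_gt0.
pose c j : R := (e j)%:R - (e k)%:R.
have ck : c k = 0 by rewrite /c subrr.
have c0 j : j != k -> c j != 0.
  by move=> jk; rewrite subr_eq0 eqr_nat; apply: contra jk => /eqP/inje ->.
have dlin (x t : R) : is_derive t 1 (fun t => x * t) x.
  by have := is_deriveZ x (is_derive_id t (1 : R)); rewrite /GRing.scale/= mulr1.
(* The zero frequency occurs exactly at [j = k]; its primitive is linear, the only one that changes
   over a period. *)
pose G (j : nat) (t : R) : R := if j == k then a j * t else (a j / c j) * sin (c j * t).
have dG (j : nat) (t : R) : is_derive t 1 (G j) (a j * cos (c j * t)).
  rewrite /G; have [->|jk] := eqVneq j k; first by rewrite ck mul0r cos0 mulr1.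
  have := is_deriveZ (a j / c j) (is_derive1_comp (is_derive_sin (c j * t)) (dlin (c j) t)).
  rewrite /GRing.scale/= => h; apply: is_derive_eq h _.
  by rewrite mulrA mulrAC divfK ?c0.
have ccos j : continuous (fun t => a j * cos (c j * t)).
  move=> t; apply: cvgM; first exact: cvg_cst.
  apply: (@continuous_comp _ _ _ (fun t : R => c j * t) cos); last exact: continuous_cos.
  by apply: cvgM; [exact: cvg_cst|exact: cvg_id].
pose F t := al * (\sum_(j < K) G j t) + be * t.
pose f t := al * (\sum_(j < K) a j * cos (((e j)%:R - (e k)%:R) * t)) + be.
have cf : continuous f.
  move=> t; apply: cvgD; last exact: cvg_cst.
  by apply: cvgM; [exact: cvg_cst|exact: (@continuous_big_sum K (fun j t => a j * cos (c j * t)))].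
have dF (t : R) : is_derive t 1 F (f t).
  apply: (@is_deriveD _ _ _ (fun t => al * (\sum_(j < K) G j t)) (fun t => be * t)) => //.
  by apply: (@is_deriveZ _ _ _ (fun t => \sum_(j < K) G j t)); exact: (@is_derive_big_sum K G (fun j t => a j * cos (c j * t)) t (dG^~ t)).
rewrite (integral_is_derive pi0 cf dF) /F; congr EFin.
rewrite !mulr0 addr0.
have -> : \sum_(j < K) G j 0 = 0.
  by apply: big1 => j _; rewrite /G; case: ifP; rewrite mulr0 ?sin0 ?mulr0.
have -> : \sum_(j < K) G j (2 * pi) = a k * (2 * pi).
  rewrite (bigD1 (Ordinal kK))//= big1 ?addr0; first by rewrite /G eqxx.
  move=> j; rewrite -val_eqE/= => jk; rewrite /G (negbTE jk) /c.
  (* The frequency may be negative; adding [e k] periods turns the argument into [e j] periods. *)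
  have := sin_natD2pi (e k) (((e j)%:R - (e k)%:R) * (2 * pi)).
  have := sin_natD2pi (e j) 0.
  by rewrite -mulrDl subrK add0r sin0 => -> <-; rewrite mulr0.
by ring.
Qed.

Lemma bounded_sums_tail (u : nat -> R) (eps : R) : bounded_sums u -> 0 < eps ->
  exists K0, forall K L, (K0 <= K)%N -> (K <= L)%N ->
    (forall k, 0 <= u k) -> \sum_(k < L) u k - \sum_(k < K) u k <= eps.
Proof.
move=> [B hB] eps0; pose S := [set \sum_(k < K) u k | K in [set: nat]].
have hS : has_sup S by split; [exists (\sum_(k < 0) u k); exists 0%N|exists B => _ [K _ <-]].
have [_ [K0 _ <-] hK0] := sup_adherent eps0 hS.
exists K0 => K L K0K KL u0.
have h1 : \sum_(k < L) u k <= sup S by apply: ub_le_sup; [exact: hS.2|exists L].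
have h2 : \sum_(k < K0) u k <= \sum_(k < K) u k.
  by rewrite -(subnKC K0K) big_split_ord/= lerDl sumr_ge0.
by rewrite /S in h1 hK0 *; lra.
Qed.

(** The tangent to [w ^ p] at [m] lies below the curve, by Young's inequality for [w] and
    [m ^ (p - 1)]. It reduces a lower bound for a [p]-th power mean to a linear integral. *)
Lemma powR_young (w m p : R) : 0 <= w -> 0 <= m -> 1 < p ->
  p * m `^ (p - 1) * w - (p - 1) * m `^ p <= w `^ p.
Proof.
move=> w0 m0 p1; have p0 : 0 < p by lra.
have q0 : 0 < p / (p - 1) by rewrite divr_gt0//; lra.
have := conjugate_powR w0 (powR_ge0 m (p - 1)) p0 q0.
rewrite -powRrM mulrCA mulfV ?mulr1; last by rewrite subr_eq0 gt_eqF.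
have -> : p^-1 + (p / (p - 1))^-1 = 1 by field; rewrite !gt_eqF//; lra.
move=> /(_ erefl); rewrite -(ler_pM2l p0).
have -> : p * (w `^ p / p + m `^ p / (p / (p - 1))) = w `^ p + (p - 1) * m `^ p.
  by field; rewrite !gt_eqF//; lra.
by move: (m `^ (p - 1)) (m `^ p) (w `^ p) => X Y Z; lra.
Qed.

End trigonometric_integral.

(** * Integral means bound the coefficients from above *)

Section integral_mean.
Variable R : realType.
Local Notation mu := (@lebesgue_measure R).
Local Open Scope complex_scope.

Lemma polarM (a b s t : R) : (polar a s : R[i]) * polar b t = polar (a * b) (s + t).
Proof.
by apply/eqP; rewrite eq_complex/= cosD sinD; apply/andP; split; apply/eqP; ring.
Qed.

Lemma polarX (r t : R) n : (polar r t : R[i]) ^+ n = polar (r ^+ n) (n%:R * t).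
Proof.
elim: n => [|n IH]; first by rewrite !expr0 mul0r /polar sin0 cos0 /cpt mulr0 mulr1.
by rewrite exprS IH polarM -natr1 mulrDl mul1r addrC exprS.
Qed.

Lemma cabs_polar (r t : R) : 0 <= r -> cabs (polar r t) = r.
Proof.
move=> r0; rewrite /cabs/= !exprMn -mulrDr cos2Dsin2 mulr1 sqrtr_sqr ger0_norm//.
Qed.

(* For a lacunary series [G], the cosine sum is the real part of a partial sum of [exp (- i (e k) t) * G], so
   that its mean over the circle is the coefficient [a k]. *)
Lemma integral_mean_ge (p r : R) (a : nat -> R) (e : nat -> nat) (G : Cpl R -> Cpl R) K k
    (B : R) :
  1 < p -> 0 <= r -> injective e -> (k < K)%N -> 0 < a k ->
  (forall t, cabs (G (polar r t)) <= B) ->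
  (forall t, \sum_(j < K) a j * cos (((e j)%:R - (e k)%:R) * t) - a k / (2 * p)
     <= cabs (G (polar r t))) ->
  a k / 2 <= Mp p r G.
Proof.
move=> p1 r0 inje kK ak GB Gg; have p0 : 0 < p by lra.
have pi0 : 0 < 2 * pi :> R by rewrite mulr_gt0// pi_gt0.
set m := a k in ak Gg *.
(* Slope of the tangent at [m]. The tolerated error [m / (2 * p)] then costs [m ^ p / 2], half of
   the mean of the tangent. *)
pose al := p * m `^ (p - 1).
pose be := - (al * (m / (2 * p))) - (p - 1) * m `^ p.
have al0 : 0 <= al by rewrite mulr_ge0 ?powR_ge0 ?ltW.
pose h t := al * (\sum_(j < K) a j * cos (((e j)%:R - (e k)%:R) * t)) + be.
set I := (\int[mu]_(t in `[0%R, (2 * pi)%R]) (cabs (G (polar r t)) `^ p)%:E)%E.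
have mm : m `^ (p - 1) * m = m `^ p.
  by rewrite -[X in _ * X]powRr1 ?ltW// -powRD ?subrK// gt_eqF.
have hI : ((2 * pi * (m `^ p / 2))%:E <= I)%E.
  have -> : 2 * pi * (m `^ p / 2) = 2 * pi * (al * m + be).
    rewrite /be /al -mm; move: (m `^ (p - 1)) => X.
    by field; rewrite gt_eqF.
  rewrite -(integral_cos_sum a al be kK inje) integralE.
  (* [h] may be negative, so the comparison goes through its positive part. *)
  apply: (@le_trans _ _ (\int[mu]_(t in `[0%R, (2 * pi)%R]) ((fun t => (h t)%:E)^\+ t))%E).
    by rewrite -[leRHS]sube0 leeB ?integral_ge0.
  apply: le_integral_nonmeasurable => t _; first exact: funepos_ge0.
  rewrite funeposE ge_max lee_fin; apply/andP; split; last by rewrite lee_fin powR_ge0.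
  apply: le_trans (powR_young (cabs_ge0 _) (ltW ak) p1).
  rewrite /h /be; have := ler_wpM2l al0 (Gg t); rewrite mulrBr /al.
  by move: (m `^ p) => X; lra.
(* [Mp] applies [fine], which sends an infinite integral to 0, so finiteness has to be secured. *)
have Iub : (I < +oo)%E.
  have B0 : 0 <= B by apply: le_trans (GB 0); exact: cabs_ge0.
  apply: (@le_lt_trans _ _ (\int[mu]_(t in `[0%R, (2 * pi)%R]) (B `^ p)%:E)%E).
    apply: le_integral_nonmeasurable => t _; first by rewrite lee_fin powR_ge0.
    rewrite lee_fin; apply: ge0_ler_powR; rewrite ?nnegrE ?cabs_ge0//; exact: ltW.
  rewrite integral_cst//= lebesgue_measure_itv/= lte_fin pi0 -EFinB -EFinM.
  exact: ltry.
have I0 : (0 <= I)%E by apply: integral_ge0 => t _; rewrite lee_fin powR_ge0.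
rewrite /Mp -/I.
have {I0 Iub} : (I \is a fin_num) by rewrite ge0_fin_numE.
move: I hI => [x||]//= hx _; rewrite lee_fin in hx.
have {}hx : m `^ p / 2 <= (2 * pi)^-1 * x by rewrite ler_pdivlMl.
have m2 : 0 <= m / 2 by rewrite divr_ge0// ltW.
have -> : m / 2 = ((m / 2) `^ p) `^ p^-1 by rewrite -powRrM mulfV ?gt_eqF// powRr1.
apply: ge0_ler_powR; rewrite ?nnegrE ?powR_ge0 ?invr_ge0 ?(ltW p0)//.
  by apply: le_trans hx; rewrite divr_ge0// powR_ge0.
(* Since [p > 1], [(1 / 2) ^ p <= 1 / 2]. *)
apply: le_trans hx; rewrite powRM ?invr_ge0 ?(ltW ak)// ler_wpM2l ?powR_ge0//.
rewrite -[leRHS]powRr1// -[2^-1]powR_inv1// -!powRrM.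
by apply: ler_powR; rewrite ?ler1n//; lra.
Qed.

End integral_mean.

(** [K] is taken so large that the remaining moduli sum to at most [a k / (2 * p)], the error
    allowed by [integral_mean_ge]. *)
Lemma Mp_lacunary (R : realType) (N : nat) (psi : nat -> R) (p r : R) (G : Cpl R -> Cpl R) k :
  4 <= N%:R :> R -> (forall k, 0 < psi k) -> (forall k, 17 * psi k <= psi k.+1) ->
  (forall k, psi k.+1 <= N%:R ^+ 2 * psi k) -> 1 < p -> 0 < r -> r < 1 ->
  (forall t, G (polar r t) = lacunary_derivative N psi (polar r t)) ->
  psi k * r ^+ (N ^ k).-1 / 2 <= Mp p r G.
Proof.
move=> hN psi0 hlb hub p1 r0 r1 hG.
have N4 := N_ge4 hN.
have sr := lacunary_summable hN psi0 hub (ltW r0) r1.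
pose a j := psi j * r ^+ (N ^ j).-1.
have a0 j : 0 < a j by rewrite mulr_gt0// exprn_gt0.
have eps0 : 0 < a k / (2 * p) by rewrite divr_gt0// mulr_gt0//; lra.
have [K0 hK0] := bounded_sums_tail sr eps0.
pose K := maxn K0 k.+1.
have cz t : cabs (polar r t) = r by rewrite cabs_polar// ltW.
have cs t : bounded_sums (fun k => cabs ((psi k)%:C%C * (polar r t : R[i]) ^+ (N ^ k).-1)).
  by apply: bounded_sums_le sr => j; rewrite (lacunary_term_abs _ psi0) cz.
have [B hB] := sr.
apply: (@integral_mean_ge _ p r a (fun j => (N ^ j).-1) G K k B) => //.
- exact: ltW.
- move=> i j ij; apply: (@expnI N); first by apply: leq_trans N4.
  have Npos n : (0 < N ^ n)%N by rewrite expn_gt0 (leq_trans _ N4).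
  by rewrite -(prednK (Npos i)) -(prednK (Npos j)) ij.
- exact: leq_maxr.
- move=> t; rewrite hG -[X in cabs X]subr0; apply: (csum_near (L := 0%N) (cs t)) => L _.
  rewrite subr0; apply: le_trans (ler_cabs_sum _ _ _) _; apply: le_trans (hB L).
  by apply: ler_sum => j _; rewrite (lacunary_term_abs _ psi0) cz.
- move=> t; rewrite hG; set z : R[i] := polar r t.
  set S : R[i] := \sum_(j < K) (psi j)%:C%C * z ^+ (N ^ j).-1.
  have hS : cabs (lacunary_derivative N psi z - S) <= a k / (2 * p).
    apply: (csum_near (L := K) (cs t)) => L /subnKC <-; move: (L - K)%N => M.
    rewrite /S big_split_ord/= addrAC subrr add0r.
    apply: le_trans (ler_cabs_sum _ _ _) _.
    have := hK0 K (K + M)%N (leq_maxl _ _) (leq_addr _ _) (fun j => ltW (a0 j)).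
    rewrite big_split_ord/= addrAC subrr add0r; apply: le_trans.
    by apply: ler_sum => j _; rewrite (lacunary_term_abs _ psi0) cz.
  have Sa : \sum_(j < K) a j * cos (((N ^ j).-1%:R - (N ^ k).-1%:R) * t) <= cabs S.
    (* A unimodular factor subtracts the [k]-th frequency from all the others before real parts are
       taken. *)
    have -> : cabs S = cabs (S * polar 1 (- ((N ^ k).-1%:R * t))).
      by rewrite cabsM cabs_polar// mulr1.
    apply: le_trans (ler_Re_cabs _); apply: le_trans (ler_norm _).
    rewrite /S mulr_suml -(Re_series (fun j => (psi j)%:C%C * z ^+ (N ^ j).-1 * polar 1 (- ((N ^ k).-1%:R * t)))) seriesEord/= le_eqVlt; apply/orP; left; apply/eqP.
    apply: eq_bigr => j _; rewrite /z polarX -mulrA polarM mulr1 /= mul0r subr0 mulrA.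
    by rewrite -mulrBl.
  by have := ler_cabsB S (S - lacunary_derivative N psi z); rewrite subKr -(cabsN (S - _)) opprB; lra.
Qed.

(** * Comparison of powers and geometric levels *)

Section comparison.
Variable R : realType.

(** Two-sided comparability serves both signs of the exponent: [p - 2] and [q - 2] may be
    negative. *)
Lemma powR_compare (M x y al : R) : 1 <= M -> 0 < x -> 0 < y -> x <= M * y -> y <= M * x ->
  x `^ al <= M `^ `|al| * y `^ al.
Proof.
move=> M1 x0 y0 xy yx; have M0 : 0 < M by lra.
have [al0|al0] := leP 0 al.
  rewrite ger0_norm// -powRM ?(ltW M0) ?(ltW y0)//; apply: ge0_ler_powR => //; rewrite nnegrE.
    exact: ltW.
  by rewrite mulr_ge0// ltW.
rewrite ltr0_norm//; have [be be0 ->] : exists2 be, 0 <= be & al = - be.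
  by exists (- al); rewrite ?opprK// oppr_ge0 ltW.
rewrite opprK.
rewrite !powRN ler_pdivlMr ?powR_gt0// mulrC ler_pdivrMr ?powR_gt0//.
by rewrite -powRM ?(ltW M0) ?(ltW x0)//; apply: ge0_ler_powR => //; rewrite nnegrE ltW// mulr_gt0.
Qed.

Lemma trivIset_levels (T : Type) (s : T -> R) (u : nat -> R) (A : nat -> set T) :
  {homo u : m n / (m <= n)%N >-> m <= n} ->
  (forall k x, A k x -> u k <= s x < u k.+1) -> trivIset setT A.
Proof.
move=> hu hA; apply: ltn_trivIset => i j ij; rewrite -subset0 => x [/hA/andP[_ h1] /hA/andP[h2 _]].
by have := hu _ _ ij; lra.
Qed.

Lemma geometric_level (y r : R) : 0 < y -> y < 1 -> 0 <= r -> r < 1 ->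
  exists k, 1 - y ^+ k <= r < 1 - y ^+ k.+1.
Proof.
move=> y0 y1 r0 r1.
have hex : exists k, y ^+ k.+1 < 1 - r.
  (* [pow_decay] with exponent 1 bounds [k * (1 - y) * y ^+ k] by 2, so this [k] is large enough. *)
  pose k := Num.bound (2 / ((1 - y) * (1 - r))); exists k.
  have h0 : 0 < (1 - y) * (1 - r) by rewrite mulr_gt0; lra.
  have hk : 2 / ((1 - y) * (1 - r)) < k%:R by apply: archi_boundP; rewrite divr_ge0// ltW.
  have k0 : 0 < k%:R :> R by apply: le_lt_trans hk; rewrite divr_ge0// ltW.
  have : y ^+ k * (k%:R * (1 - y)) <= 2.
    have := pow_decay (r := y) (m := k) (n := k%:R) 1 (ltW y0) (ltW y1) (ltW k0).
    by rewrite !expr1 muln1; apply; rewrite ler_peMl ?ler1n// ltW.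
  have := hk; rewrite ltr_pdivrMr// => {}hk h2.
  have : y ^+ k < 1 - r.
    rewrite -(ltr_pM2r (_ : 0 < k%:R * (1 - y))); last by rewrite mulr_gt0// subr_gt0.
    by apply: le_lt_trans h2 _; rewrite mulrC -mulrA.
  by apply: le_lt_trans; rewrite exprS ler_piMl ?exprn_ge0 ?(ltW y0) ?(ltW y1).
exists (ex_minn hex); case: ex_minnP => k hk kmin; apply/andP; split; last by lra.
case: k hk kmin => [|k] _ kmin; first by rewrite expr0 subrr.
have : ~~ (y ^+ k.+1 < 1 - r) by apply/negP => /kmin; rewrite ltnn.
by rewrite -leNgt; lra.
Qed.

Lemma not_bounded_sums_integral (u : nat -> R) (kap : R) (I : \bar R) :
  ~ bounded_sums u -> 0 < kap -> (forall K, ((kap * \sum_(k < K) u k)%:E <= I)%E) ->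
  I = +oo%E.
Proof.
move=> nu k0 hI; case: I hI => [x|//|] hI.
- by exfalso; apply: nu; exists (x / kap) => K; rewrite ler_pdivlMr// mulrC -lee_fin.
- by have := hI 0%N.
Qed.

End comparison.

(** * From integrals over the radius or the disc to sums over levels *)

Section radial_profile.
Variables (R : realType) (N : nat).
Local Notation mu := (@lebesgue_measure R).
Hypothesis hN : 4 <= N%:R :> R.
Local Notation y := (N%:R^-1 : R).

Let N0 : 0 < N%:R :> R. Proof. by apply: lt_le_trans hN; rewrite ltr0n. Qed.
Let N1 : 1 <= N%:R :> R. Proof. by apply: le_trans hN; rewrite ler1n. Qed.
Let y0 : 0 < y. Proof. by rewrite invr_gt0. Qed.
Let y4 : y <= 4^-1. Proof. by rewrite lef_pV2// posrE. Qed.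
Let y_lt1 : y < 1. Proof. by apply: le_lt_trans y4 _; lra. Qed.
Let Ny (x : R) : N%:R * (y * x) = x. Proof. by rewrite mulVKf// gt_eqF. Qed.
Let Y0 k : 0 < y ^+ k. Proof. exact: exprn_gt0. Qed.
Let Y1 k : y ^+ k <= 1. Proof. by apply: exprn_ile1; exact: ltW. Qed.
Let YS k : y ^+ k.+1 = y * y ^+ k. Proof. exact: exprS. Qed.

Let level_homo : {homo (fun k => 1 - y ^+ k) : m n / (m <= n)%N >-> m <= n}.
Proof. by move=> m n mn; rewrite lerD2l lerN2 ler_wiXn2l// ltW. Qed.

Let powR_level (k : nat) (p : R) : (y ^+ k) `^ (p - 2) * y ^+ k = (y ^+ k) `^ (p - 1).
Proof.
rewrite -[X in _ * X]powRr1 ?(ltW (Y0 k))// -powRD; last by apply/implyP => _; rewrite gt_eqF.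
by congr powR; lra.
Qed.

Variable phi : R -> R.
Hypothesis phi_pos : forall r : R, 0 <= r < 1 -> 0 < phi r.
Hypothesis phi_incr : forall r s : R, 0 <= r -> r <= s -> s < 1 -> phi r <= phi s.

Let level_pos k : 0 <= 1 - y ^+ k < 1.
Proof. by rewrite subr_ge0 Y1/= ltrBlDr ltrDl. Qed.

(** The sample at [1 - y ^+ k.+1] is the minimum of [phi] on the level that starts there; on it
    [1 - r] is still within a factor [N ^ 2] of [y ^+ k]. *)
Lemma profile_bounded_sums (p : R) : 1 < p ->
  (\int[mu]_(r in `[0%R, 1%R[) ((1 - r) `^ (p - 2) * (phi r) `^ p)%:E < +oo)%E ->
  bounded_sums (fun k => (y ^+ k) `^ (p - 1) * phi (1 - y ^+ k.+1) `^ p).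
Proof.
move=> p1 hp; set I := (\int[mu]_(r in _) _)%E in hp.
have I0 : (0 <= I)%E.
  by apply: integral_ge0 => r _; rewrite lee_fin mulr_ge0 ?powR_ge0.
pose M := (N%:R * N%:R) `^ `|p - 2|.
have M0 : 0 < M by rewrite powR_gt0// mulr_gt0.
pose kap := M^-1 * (y - y * y).
have kap0 : 0 < kap by rewrite mulr_gt0 ?invr_gt0// subr_gt0 gtr_pMr.
exists (fine I / kap) => K; rewrite ler_pdivlMr// mulrC -lee_fin fineK ?ge0_fin_numE//.
pose c k := M^-1 * ((y ^+ k) `^ (p - 2) * phi (1 - y ^+ k.+1) `^ p).
pose a k := y ^+ k.+1 - y ^+ k.+2.
rewrite (_ : kap * _ = \sum_(k < K) c k * a k); last first.
  rewrite mulr_sumr; apply: eq_bigr => k _; rewrite -powR_level /c /a /kap !YS.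
  by move: (y ^+ k) (_ `^ (p - 2)) (_ `^ p) => X Z W; ring.
apply: (@series_le_integral _ _ _ mu _ (fun k => `[1 - y ^+ k.+1, 1 - y ^+ k.+2[%classic)) => //.
- by move=> k; rewrite mulr_ge0 ?invr_ge0 ?(ltW M0)// mulr_ge0 ?powR_ge0.
- by move=> r _; rewrite mulr_ge0 ?powR_ge0.
- apply: (@trivIset_levels _ _ id (fun k => 1 - y ^+ k.+1)).
    by move=> m n mn; apply: level_homo.
  by move=> k r /=; rewrite in_itv.
- move=> k r /=; rewrite in_itv/= => /andP[r1 r2].
  have /andP[l1 l2] := level_pos k.+1.
  have rl1 : r < 1 by have := Y0 k.+2; lra.
  split; first by rewrite /= in_itv/= rl1 andbT; apply: le_trans r1.
  rewrite /c mulrA; apply: ler_pM; rewrite ?mulr_ge0 ?invr_ge0 ?powR_ge0 ?(ltW M0)//.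
    rewrite ler_pdivrMl//; apply: powR_compare => //; rewrite ?mulr_ege1//.
    + by rewrite subr_gt0.
    + rewrite -mulrA -[leLHS]Ny ler_pM2l// -[leLHS]Ny ler_pM2l// -!YS; lra.
    + have : 1 - r <= y ^+ k.
        have := YS k; have : y * y ^+ k <= y ^+ k by rewrite ler_piMl ?ltW.
        by lra.
      move/le_trans; apply; rewrite ler_peMl ?(ltW (Y0 k))// mulr_ege1//.
  apply: ge0_ler_powR; rewrite ?nnegrE; [by lra| | |].
  - by apply: ltW; apply: phi_pos; rewrite l1.
  - by apply: ltW; apply: phi_pos; rewrite rl1 andbT (le_trans l1).
  - exact: phi_incr.
- move=> k; rewrite /= itv_co_length ?lee_fin /a; first by lra.
  by rewrite lerD2l lerN2 ler_wiXn2l// ltW.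
Qed.

(** The same sample bounds [phi] from above on the level that ends there, so one sequence serves
    both integrals. *)
Lemma profile_unbounded_sums (q : R) : 1 < q ->
  (\int[mu]_(r in `[0%R, 1%R[) ((1 - r) `^ (q - 2) * (phi r) `^ q)%:E = +oo)%E ->
  ~ bounded_sums (fun k => (y ^+ k) `^ (q - 1) * phi (1 - y ^+ k.+1) `^ q).
Proof.
move=> q1 hq [B hB].
pose M := N%:R `^ `|q - 2|.
have M0 : 0 < M by rewrite powR_gt0.
pose c k := M * ((y ^+ k) `^ (q - 2) * phi (1 - y ^+ k.+1) `^ q).
suff : (\int[mu]_(r in `[0%R, 1%R[) ((1 - r) `^ (q - 2) * (phi r) `^ q)%:E <= (M * B)%:E)%E.
  by rewrite hq.
apply: (@integral_le_series _ _ _ mu _ (fun k => `[1 - y ^+ k, 1 - y ^+ k.+1[%classic) c (fun k => y ^+ k)) => //.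
- by move=> k; rewrite !mulr_ge0 ?powR_ge0 ?ltW.
- by move=> r _; rewrite mulr_ge0 ?powR_ge0.
- move=> r /=; rewrite in_itv/= => /andP[r0 r1].
  have [k /andP[h1 h2]] := geometric_level y0 y_lt1 r0 r1.
  have /andP[l1 l2] := level_pos k.+1.
  exists k; first by rewrite /= in_itv/= h1.
  rewrite /c mulrA; apply: ler_pM; rewrite ?powR_ge0//.
    apply: powR_compare => //; first by rewrite subr_gt0.
    + apply: (@le_trans _ _ (y ^+ k)); first by lra.
      by rewrite ler_peMl// ltW.
    + by rewrite -[leLHS]Ny ler_pM2l// -YS; lra.
  apply: ge0_ler_powR; rewrite ?nnegrE; [by lra| | |].
  - by apply: ltW; apply: phi_pos; rewrite r0.
  - by apply: ltW; apply: phi_pos; rewrite l1.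
  - by apply: phi_incr => //; exact: ltW.
- move=> k; rewrite /= itv_co_length; last by rewrite lerD2l lerN2 ler_wiXn2l// ltW.
  by rewrite lee_fin; have := Y0 k.+1; lra.
- move=> K; apply: le_trans (ler_wpM2l (ltW M0) (hB K)).
  rewrite mulr_sumr; apply: ler_sum => k _; rewrite /c -powR_level.
  by rewrite le_eqVlt; apply/orP; left; apply/eqP; ring.
Qed.

Variable psi : nat -> R.
Hypothesis hy : 432 * 8 * y <= 16^-1.
Hypothesis psi0 : forall k, 0 < psi k.
Hypothesis psi_lb : forall k, 17 * psi k <= psi k.+1.
Hypothesis psi_ub : forall k, psi k.+1 <= N%:R ^+ 2 * psi k.
Variable G : Cpl R -> Cpl R.
Hypothesis hG : forall z, cabs z < 1 -> G z = lacunary_derivative N psi z.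

Let NY k : N%:R ^+ k * y ^+ k = 1 :> R.
Proof. by rewrite -exprMn mulfV ?expr1n// gt_eqF. Qed.

(** The area of the level annulus, at most [48 * y ^+ k], raises the exponent of [y ^+ k] from
    [p - 2] to [p - 1]. *)
Lemma lacunary_area_integral_finite (p : R) : 1 < p ->
  bounded_sums (fun k => (y ^+ k) `^ (p - 1) * psi k `^ p) ->
  (area_integral (fun z => (1 - cabs z ^+ 2) `^ (p - 2) * (cabs (G z)) `^ p)%R < +oo)%E.
Proof.
move=> p1 [B hB].
pose C := (2 + 432 * N%:R ^+ 2) `^ p : R.
pose M := N%:R `^ `|p - 2|.
pose c k := M * (y ^+ k) `^ (p - 2) * (C * psi k `^ p).
have C1 : 0 <= 2 + 432 * N%:R ^+ 2 :> R by rewrite addr_ge0// mulr_ge0// exprn_ge0// ltW.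
have C0 : 0 <= C by exact: powR_ge0.
have M0 : 0 <= M by exact: powR_ge0.
rewrite /area_integral; set I := (\int[_]_(z in _) _)%E.
suff hI : (I <= (48 * M * C * B)%:E)%E.
  apply: (@le_lt_trans _ _ (pi^-1 * (48 * M * C * B))%:E); last exact: ltry.
  by rewrite EFinM lee_pmul2l// lte_fin invr_gt0 pi_gt0.
pose A k := [set z : R * R | cabs (cpt z.1 z.2) \in `[1 - y ^+ k, 1 - y ^+ k.+1[%R].
rewrite /I; apply: (@integral_le_series _ _ _ (mu \x mu)%E _ A c (fun k => 48 * y ^+ k)).
- by move=> k; exact: measurable_annulus.
- by move=> k; rewrite /c !mulr_ge0 ?powR_ge0.
- by move=> z _; rewrite mulr_ge0 ?powR_ge0.
- move=> z /= z1; have z0 := cabs_ge0 (cpt z.1 z.2).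
  set r := cabs _ in z0 z1 *.
  have [k /andP[h1 h2]] := geometric_level y0 y_lt1 z0 z1.
  exists k; first by rewrite /A/= in_itv/= h1.
  rewrite hG// /c; apply: ler_pM; rewrite ?powR_ge0//.
    have d0 : 0 < 1 - r by lra.
    have r2 : 1 - r ^+ 2 = (1 - r) * (1 + r) by ring.
    have W0 : 0 < (1 - r) * (1 + r) by rewrite mulr_gt0//; lra.
    apply: powR_compare => //; rewrite r2//.
    + apply: (@le_trans _ _ (4 * y ^+ k)); first by nra.
      by rewrite ler_wpM2r// ltW.
    + by rewrite -[leLHS]Ny ler_pM2l// -YS; nra.
  rewrite -powRM ?(ltW (psi0 _))//; apply: ge0_ler_powR; rewrite ?nnegrE ?cabs_ge0//; first by lra.
    by rewrite mulr_ge0// ltW.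
  apply: lacunary_upper => //.
  apply: (@le_trans _ _ (N%:R ^+ k * y ^+ k.+1)); first by rewrite YS mulrCA NY mulr1.
  by rewrite ler_wpM2l ?exprn_ge0 ?(ltW N0)//; rewrite -/r; lra.
- move=> k; have YSk := YS k; have y1k : y ^+ k.+1 <= y ^+ k by rewrite ler_wiXn2l// ltW.
  have y2 : y ^+ k.+1 <= 4^-1.
    by rewrite YS; apply: le_trans y4; rewrite ler_piMr// ltW.
  apply: le_trans (annulus_area_le _ _ _ _) _; [|by lra|by have := Y0 k.+1; lra|by lra|].
    by have := Y1 k; lra.
  by rewrite lee_fin ler_pM2l//; have := Y0 k.+1; lra.
- move=> K; apply: le_trans (ler_wpM2l _ (hB K)); last by rewrite !mulr_ge0.
  rewrite mulr_sumr; apply: ler_sum => k _; rewrite /c -powR_level.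
  by rewrite le_eqVlt; apply/orP; left; apply/eqP; ring.
Qed.

(** [X] stands for [1 - r] in the radial integral and for [1 - cabs z ^+ 2] in the area integral. *)
Lemma lacunary_weighted_lower (q X : R) k z : 1 < q ->
  2^-1 * y ^+ k <= 1 - cabs z -> 1 - cabs z <= 3 / 4 * y ^+ k ->
  2^-1 * y ^+ k <= X -> X <= 2 * y ^+ k ->
  (N%:R `^ `|q - 2|)^-1 * (y ^+ k) `^ (q - 2) * (8^-1 `^ q * psi k `^ q)
    <= X `^ (q - 2) * cabs (G z) `^ q.
Proof.
move=> q1 h1 h2 h3 h4; have Yk := Y0 k.
have X0 : 0 < X by lra.
have M0 : 0 < N%:R `^ `|q - 2| :> R by rewrite powR_gt0.
have Nk : 0 < N%:R ^+ k :> R by rewrite exprn_gt0.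
apply: ler_pM; rewrite ?mulr_ge0 ?powR_ge0 ?invr_ge0 ?(ltW M0)//.
  rewrite ler_pdivrMl//; apply: powR_compare => //.
  + apply: (@le_trans _ _ (4 * X)); first by lra.
    by rewrite ler_wpM2r// ltW.
  + apply: (@le_trans _ _ (4 * y ^+ k)); first by lra.
    by rewrite ler_wpM2r// ltW.
have z1 : cabs z < 1 by lra.
rewrite -powRM ?(ltW (psi0 _))//; apply: ge0_ler_powR; rewrite ?nnegrE ?cabs_ge0//; first by lra.
  by rewrite mulr_ge0// ltW.
rewrite mulrC hG//; apply: lacunary_lower => //.
  by have := ler_wpM2l (ltW Nk) h1; rewrite mulrCA NY mulr1.
by have := ler_wpM2l (ltW Nk) h2; rewrite mulrCA NY mulr1.
Qed.

(** As [y <= 1 / 4], the shrunk intervals stay inside the levels; their disjointness follows. *)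
Let A_levels k (r : R) : r \in `[1 - 3 / 4 * y ^+ k, 1 - 2^-1 * y ^+ k]%R ->
  1 - y ^+ k <= r < 1 - y ^+ k.+1.
Proof.
rewrite in_itv/= => /andP[h1 h2]; have Yk := Y0 k.
have : y ^+ k.+1 <= 4^-1 * y ^+ k by rewrite YS ler_wpM2r// ltW.
by lra.
Qed.

Lemma lacunary_radial_integral_infinite (q t : R) : 1 < q ->
  ~ bounded_sums (fun k => (y ^+ k) `^ (q - 1) * psi k `^ q) ->
  (\int[mu]_(r in `[0%R, 1%R[)
     ((1 - r) `^ (q - 2) * (cabs (G (polar r t))) `^ q)%:E = +oo)%E.
Proof.
move=> q1 nb.
pose M := (N%:R `^ `|q - 2|)^-1 : R.
have M0 : 0 < M by rewrite invr_gt0 powR_gt0.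
have e0 : 0 < 8^-1 `^ q :> R by rewrite powR_gt0.
(* The last factor comes from the interval length [(3 / 4 - 1 / 2) * y ^+ k]. *)
apply: (not_bounded_sums_integral nb (kap := M * 8^-1 `^ q * 4^-1)).
  by rewrite !mulr_gt0.
move=> K; pose c k := M * (y ^+ k) `^ (q - 2) * (8^-1 `^ q * psi k `^ q).
rewrite (_ : _ * _ = \sum_(k < K) c k * (4^-1 * y ^+ k)); last first.
  rewrite mulr_sumr; apply: eq_bigr => k _; rewrite -powR_level /c.
  by move: (y ^+ k) (_ `^ (q - 2)) (psi k `^ q) (8^-1 `^ q) => X Z W V; ring.
apply: (@series_le_integral _ _ _ mu _ (fun k => `[1 - 3 / 4 * y ^+ k, 1 - 2^-1 * y ^+ k]%classic) c (fun k => 4^-1 * y ^+ k)) => //.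
- by move=> k; rewrite !mulr_ge0 ?powR_ge0 ?(ltW M0).
- by move=> r _; rewrite mulr_ge0 ?powR_ge0.
- by apply: (@trivIset_levels _ _ id _ _ level_homo) => k r; exact: A_levels.
- move=> k r /=; rewrite in_itv/= => /andP[r1 r2].
  have Yk := Y0 k; have Y1k := Y1 k; have r0 : 0 <= r by lra.
  split; first by rewrite /= in_itv/=; lra.
  by apply: lacunary_weighted_lower => //; rewrite ?cabs_polar//; lra.
- by move=> k; have Yk := Y0 k; rewrite /= itv_cc_length ?lee_fin; lra.
Qed.

Lemma lacunary_area_integral_infinite (q : R) : 1 < q ->
  ~ bounded_sums (fun k => (y ^+ k) `^ (q - 1) * psi k `^ q) ->
  (area_integral (fun z => (1 - cabs z ^+ 2) `^ (q - 2) * (cabs (G z)) `^ q)%R = +oo)%E.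
Proof.
move=> q1 nb; rewrite /area_integral; set I := (\int[_]_(z in _) _)%E.
suff -> : I = +oo%E by rewrite gt0_muley// lte_fin invr_gt0 pi_gt0.
pose M := (N%:R `^ `|q - 2|)^-1 : R.
have M0 : 0 < M by rewrite invr_gt0 powR_gt0.
have e0 : 0 < 8^-1 `^ q :> R by rewrite powR_gt0.
apply: (not_bounded_sums_integral nb (kap := M * 8^-1 `^ q * (4^-1 / 16))).
  by rewrite !mulr_gt0.
move=> K; pose c k := M * (y ^+ k) `^ (q - 2) * (8^-1 `^ q * psi k `^ q).
rewrite (_ : _ * _ = \sum_(k < K) c k * (4^-1 * y ^+ k / 16)); last first.
  rewrite mulr_sumr; apply: eq_bigr => k _; rewrite -powR_level /c.
  by move: (y ^+ k) (_ `^ (q - 2)) (psi k `^ q) (8^-1 `^ q) => X Z W V; ring.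
pose A k := [set z : R * R | cabs (cpt z.1 z.2) \in `[1 - 3 / 4 * y ^+ k, 1 - 2^-1 * y ^+ k]%R].
rewrite /I; apply: (@series_le_integral _ _ _ (mu \x mu)%E _ A c (fun k => 4^-1 * y ^+ k / 16)).
- by move=> k; exact: measurable_annulus.
- by move=> k; rewrite !mulr_ge0 ?powR_ge0 ?(ltW M0).
- by move=> r _; rewrite mulr_ge0 ?powR_ge0.
- by apply: (@trivIset_levels _ _ (fun z => cabs (cpt z.1 z.2)) _ _ level_homo) => k r; exact: A_levels.
- move=> k z; rewrite /A/= in_itv/=; set r := cabs _ => /andP[r1 r2].
  have Yk := Y0 k; have Y1k := Y1 k; have r0 : 0 <= r by lra.
  split; first by lra.
  have r2E : 1 - r ^+ 2 = (1 - r) * (1 + r) by ring.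
  by apply: lacunary_weighted_lower => //; rewrite -/r ?r2E; nra.
- move=> k; have Yk := Y0 k; have Y1k := Y1 k.
  (* The factor [3 / 4] keeps the inner radius at least [1 / 4], even for [k = 0]. *)
  apply: le_trans (annulus_area_ge _ _ _); [|lra..].
  by rewrite lee_fin; lra.
Qed.

End radial_profile.

Lemma exists_lacunary_ratio (R : realType) (p : R) : 1 < p ->
  exists N : nat, [/\ 4 <= N%:R :> R, 432 * 8 * N%:R^-1 <= 16^-1 :> R &
    17 `^ p <= N%:R `^ ((p - 1) / 2)].
Proof.
move=> p1; have s0 : 0 < (p - 1) / 2 by rewrite divr_gt0//; lra.
(* [X] solves [X ^ ((p - 1) / 2) = 17 ^ p]; [Z] adds up the three lower bounds required of [N]. *)
pose X : R := (17 `^ p) `^ ((p - 1) / 2)^-1.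
have X0 : 0 <= X by exact: powR_ge0.
pose Z : R := 4 + 432 * 8 * 16 + X.
have Z0 : 0 < Z by rewrite /Z; lra.
have hN := archi_boundP (ltW Z0); exists (Num.bound Z); set N := (_%:R : R) in hN *.
have N0 : 0 < N by lra.
split; first by rewrite /Z in hN; lra.
  by rewrite ler_pdivrMr// ler_pdivlMl//; rewrite /Z in hN; lra.
have -> : 17 `^ p = X `^ ((p - 1) / 2) by rewrite /X -powRrM mulVf ?gt_eqF// powRr1 ?powR_ge0.
apply: ge0_ler_powR; rewrite ?nnegrE ?(ltW s0) ?(ltW N0)//.
by rewrite /Z in hN; lra.
Qed.

(** * The lacunary function: boundedness, derivative and means *)

Section lacunary_function.
Variables (R : realType) (N : nat) (psi : nat -> R).
Hypothesis hN : 4 <= N%:R :> R.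
Hypothesis psi0 : forall k, 0 < psi k.
Hypothesis psi_lb : forall k, 17 * psi k <= psi k.+1.
Hypothesis psi_ub : forall k, psi k.+1 <= N%:R ^+ 2 * psi k.
Local Notation y := (N%:R^-1 : R).

Definition lacunary (z : Cpl R) : Cpl R :=
  csum (fun k => (psi k * y ^+ k)%:C%C * (z : R[i]) ^+ (N ^ k)).

Let N0 : 0 < N%:R :> R. Proof. by apply: lt_le_trans hN; rewrite ltr0n. Qed.
Let y0 : 0 < y. Proof. by rewrite invr_gt0. Qed.
Let y_lt1 : y < 1. Proof. by rewrite invf_lt1//; apply: lt_le_trans hN; rewrite ltr1n. Qed.
Let b0 k : 0 <= psi k * y ^+ k. Proof. by rewrite mulr_ge0 ?exprn_ge0 ?(ltW y0)// ltW. Qed.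
Let bN k : psi k * y ^+ k * (N ^ k)%:R = psi k.
Proof. by rewrite natrX -mulrA -exprMn mulVf ?gt_eqF// expr1n mulr1. Qed.

(** Bounded terms are enough: [(y ^ k) ^ (p - 1) * psi k ^ p <= B] means
    [(psi k * y ^ k) ^ p <= B * y ^ k], so the coefficients decay like the powers of
    [y ^ (1 / p)]. *)
Lemma lacunary_coefficients_summable (p : R) : 0 < p ->
  bounded_sums (fun k => (y ^+ k) `^ (p - 1) * psi k `^ p) ->
  bounded_sums (fun k => psi k * y ^+ k).
Proof.
move=> p0 /bounded_sums_bounded[k|B B0 hB]; first by rewrite mulr_ge0 ?powR_ge0.
have yp1 : y `^ p^-1 < 1.
  have : y `^ p^-1 < 1 `^ p^-1.
    by apply: gt0_ltr_powR; rewrite ?nnegrE ?invr_gt0 ?(ltW y0).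
  by rewrite powR1.
apply: (@bounded_sums_le _ (fun k => B `^ p^-1 * (y `^ p^-1) ^+ k)); last first.
  apply: bounded_sumsZ; first exact: powR_ge0.
  by apply: bounded_sums_geometric => //; exact: powR_ge0.
move=> k; have Yk : 0 < y ^+ k by rewrite exprn_gt0.
rewrite -powR_exp ?(ltW y0)// -powRM ?(ltW Yk)//.
have -> : psi k * y ^+ k = ((psi k * y ^+ k) `^ p) `^ p^-1.
  by rewrite -powRrM mulfV ?gt_eqF// powRr1.
apply: ge0_ler_powR; rewrite ?nnegrE ?powR_ge0 ?invr_ge0 ?(ltW p0)//.
  by rewrite mulr_ge0 ?(ltW Yk).
have := hB k; rewrite -(ler_pM2r Yk); apply: le_trans.
rewrite powRM ?(ltW Yk) ?(ltW (psi0 _))// mulrC mulrAC.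
rewrite -{3}[y ^+ k]powRr1 ?(ltW Yk)// -powRD; last by apply/implyP => _; rewrite gt_eqF.
by rewrite subrK.
Qed.

Lemma lacunary_bounded : bounded_sums (fun k => psi k * y ^+ k) ->
  exists M : R, forall z, disc R z -> cabs (lacunary z) <= M.
Proof.
move=> /[dup] bs [B hB]; exists B => z z1.
have term k : cabs ((psi k * y ^+ k)%:C%C * (z : R[i]) ^+ (N ^ k)) <= psi k * y ^+ k.
  rewrite cabsM cabsX cabs_real ger0_norm//.
  by rewrite ler_piMr// exprn_ile1 ?cabs_ge0//; exact: ltW.
rewrite -[X in cabs X]subr0; apply: (csum_near (L := 0%N)); first exact: bounded_sums_le bs.
move=> K _; rewrite subr0; apply: le_trans (ler_cabs_sum _ _ _) _; apply: le_trans (hB K).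
by apply: ler_sum => k _; exact: term.
Qed.

Lemma derive_lacunary (z : Cpl R) : bounded_sums (fun k => psi k * y ^+ k) -> cabs z < 1 ->
  derivable lacunary z 1 /\ derive1 lacunary z = lacunary_derivative N psi z.
Proof.
move=> bs z1; have z0 := cabs_ge0 z.
pose rho := (1 + cabs z) / 2.
have zr : cabs z < rho by rewrite /rho; lra.
have r0 : 0 <= rho by rewrite /rho; lra.
have r1 : rho < 1 by rewrite /rho; lra.
have [|||dl ->] := @power_series_derivative _ (fun k => psi k * y ^+ k) (fun k => (N ^ k)%N) z rho b0 zr.
- apply: bounded_sums_le bs => k.
  by rewrite ler_piMr// exprn_ile1// ltW.
- apply: bounded_sums_le (lacunary_summable hN psi0 psi_ub r0 r1) => k.
  by rewrite bN.
- exact: lacunary_summable2.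
split=> //; rewrite /lacunary_derivative; congr csum.
by apply/funext => k; rewrite bN.
Qed.

(** The [k]-th coefficient is used rather than the next one: [N ^ k * (1 - r) <= y] lets Bernoulli's
    inequality keep half of it, whereas [N ^ k.+1 * (1 - r)] may reach 1. Passing to [psi k.+1],
    which is what dominates [phi r] on this level, costs [N ^ 2]. *)
Lemma Mp_lacunary_level (p r : R) (G : Cpl R -> Cpl R) k : 1 < p ->
  (forall z, cabs z < 1 -> G z = lacunary_derivative N psi z) ->
  1 - y ^+ k.+1 <= r -> r < 1 ->
  (4 * N%:R ^+ 2)^-1 * psi k.+1 <= Mp p r G.
Proof.
move=> p1 hG hr r1.
have Y1 : y ^+ k.+1 <= 2^-1.
  rewrite exprS; apply: (@le_trans _ _ (4^-1 * 1)); last by lra.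
  apply: ler_pM; rewrite ?exprn_ge0 ?(ltW y0)//; first by rewrite lef_pV2// posrE.
  by rewrite exprn_ile1// ltW.
have r0 : 0 < r by lra.
apply: le_trans (@Mp_lacunary _ N psi p r G k hN psi0 psi_lb psi_ub p1 r0 r1 _); last first.
  by move=> t; apply: hG; rewrite cabs_polar// ltW.
have N20 : 0 < N%:R ^+ 2 :> R by rewrite exprn_gt0.
have hr2 : 2^-1 <= r ^+ (N ^ k).-1.
  apply: (@le_trans _ _ (r ^+ (N ^ k))); last by rewrite ler_wiXn2l ?leq_pred// ltW.
  apply: le_trans (bernoulli_le (N ^ k) (ltW r0) (ltW r1)).
  have : (N ^ k)%:R * (1 - r) <= y.
    apply: (@le_trans _ _ ((N ^ k)%:R * y ^+ k.+1)); first by rewrite ler_wpM2l//; lra.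
    by rewrite natrX exprS mulrCA -exprMn mulfV ?gt_eqF// expr1n mulr1.
  have : y <= 4^-1 by rewrite lef_pV2// posrE.
  by move: (y) => x; lra.
rewrite ler_pdivrMl ?mulr_gt0//; apply: le_trans (psi_ub k) _.
have pk := psi0 k; have := ler_wpM2l (ltW pk) hr2.
move: (N%:R ^+ 2) N20 (r ^+ _) => m m0 s; nra.
Qed.

End lacunary_function.

Unset Implicit Arguments.

Theorem theorem1 (R : realType) (p q : R) (phi : R -> R)
  (h1q : 1 < q) (hqp : q < p)
  (phi_pos : forall r : R, 0 <= r < 1 -> 0 < phi r)
  (phi_incr : forall r s : R, 0 <= r -> r <= s -> s < 1 -> phi r <= phi s)
  (phi_p : (\int[@lebesgue_measure R]_(r in `[0%R, 1%R[)
              ((1 - r) `^ (p - 2) * (phi r) `^ p)%:E < +oo)%E)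
  (phi_q : (\int[@lebesgue_measure R]_(r in `[0%R, 1%R[)
              ((1 - r) `^ (q - 2) * (phi r) `^ q)%:E = +oo)%E) :
  exists f : Cpl R -> Cpl R,
    [/\ Besov p f, Hinfty f, ~ Besov q f,
        (exists (C r0 : R), [/\ 0 < C, 0 < r0, r0 < 1 &
            forall r : R, r0 <= r < 1 -> C * phi r <= Mp p r (derive1 f)]) &
        (forall t : R, 0 <= t <= 2 * pi ->
           (\int[@lebesgue_measure R]_(r in `[0%R, 1%R[)
              ((1 - r) `^ (q - 2) * (cabs (derive1 f (polar r t))) `^ q)%:E = +oo)%E)].
Proof.
have p1 : 1 < p by lra.
have p0 : 0 < p by lra.
have [N [hN hy h17]] := exists_lacunary_ratio p1.
have N1 : 1 < N%:R :> R by apply: lt_le_trans hN; rewrite ltr1n.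
have y0 : 0 < N%:R^-1 :> R by rewrite invr_gt0; apply: lt_trans N1.
have y1 : N%:R^-1 < 1 :> R by rewrite invf_lt1// (lt_trans _ N1).
have level k : 0 <= 1 - (N%:R^-1 : R) ^+ k < 1.
  rewrite subr_ge0 exprn_ile1 ?(ltW y0) ?(ltW y1)//=.
  by rewrite ltrBlDr ltrDl exprn_gt0.
have [psi [hphi hlb hub hpsi]] := lacunary_weights N1 p1 h17 (fun k => phi_pos _ (level k.+1))
  (profile_bounded_sums hN phi_pos phi_incr p1 phi_p).
have psi0 k : 0 < psi k by apply: lt_le_trans (hphi k); exact: phi_pos.
have psi_q : ~ bounded_sums (fun k => (N%:R^-1 ^+ k) `^ (q - 1) * psi k `^ q).
  move=> bs; apply: (profile_unbounded_sums hN phi_pos phi_incr h1q phi_q).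
  apply: bounded_sums_le bs => k; rewrite ler_wpM2l ?powR_ge0//.
  apply: ge0_ler_powR; rewrite ?nnegrE ?(ltW (psi0 _))//; first by lra.
  by apply: ltW; exact: phi_pos.
have bs := lacunary_coefficients_summable hN psi0 p0 hpsi.
have dG z : cabs z < 1 -> _ := derive_lacunary hN psi0 hub bs (z := z).
have hG z (z1 : cabs z < 1) := (dG z z1).2.
have an : analytic_in_disc (lacunary N psi) by move=> z /dG[].
exists (lacunary N psi); split.
- by split=> //; exact: (lacunary_area_integral_finite hN psi0 hlb hub hG p1 hpsi).
- by split=> //; exact: lacunary_bounded.
- by move=> [_]; rewrite (lacunary_area_integral_infinite hN hy psi0 hlb hub hG h1q psi_q).
- exists (4 * N%:R ^+ 2)^-1, (1 - N%:R^-1); split.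
  + by rewrite invr_gt0 mulr_gt0// exprn_gt0// (lt_trans _ N1).
  + by rewrite subr_gt0.
  + by rewrite ltrBlDr ltrDl.
  move=> r /andP[hr r1].
  have r0 : 0 <= r by lra.
  (* The choice [r0 = 1 - 1 / N] rules out level 0, below which there is no coefficient. *)
  have [[|k] /andP[h1 h2]] := geometric_level y0 y1 r0 r1.
    by move: h2; rewrite expr1 ltNge hr.
  apply: le_trans (Mp_lacunary_level hN psi0 hlb hub p1 hG h1 r1).
  rewrite ler_wpM2l ?invr_ge0 ?mulr_ge0 ?exprn_ge0//.
  apply: le_trans (hphi k.+1); apply: phi_incr => //; first exact: ltW.
  by have /andP[] := level k.+2.
- move=> t _; exact: (lacunary_radial_integral_infinite hN hy psi0 hlb hub hG t h1q psi_q).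
Qed.
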